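(* Under Assumptions 1 and 2, with $\hat\theta_T$ the estimator output by the dual active reward learning algorithm, $$M(\xi_T,\hat\theta_T)\xrightarrow{a.s.}M(\xi_*,\theta_* )\quad\text{as }T\to\infty.$$
   Context: Let $\mu(w)=1/(1+e^{-w})$ and $\dot\mu(w)=\mu(w)(1-\mu(w))$. Fix $d\ge1$, a compact parameter set $\Theta\subset\mathbb R^d$ containing the true unknown parameter $\theta_*$, and a known feature map $\phi:\mathcal X\times\mathcal A\to\mathbb R^d$ (contexts $\mathcal X$, actions $\mathcal A$). A finite candidate set $\mathcal Z=\{z^{(1)},\dots,z^{(n)}\}\subset\mathbb R^d$ is given, where $z^{(i)}=\phi(x^{(i)},a^{(1,i)})-\phi(x^{(i)},a^{(0,i)})$ for a prompt $x^{(i)}$ and two completions, and each $z\in\mathcal Z$ carries a category $k(z)\in\{1,\dots,g\}$. There are $m$ teachers; teacher $j$ has rationality $\beta^{(k)}_j>0$ on category $k$; $\mathcal B_k=\{\beta^{(k)}_1,\dots,\beta^{(k)}_m\}$, $\mathcal B=\bigcup_k\mathcal B_k$. Querying a teacher of rationality $\beta$ on $z$ returns $y\in\{0,1\}$ with $P(y=1)=\mu(\beta\theta_*^\top z)$. Dual active reward learning algorithm: start from initial pairs $(z_1,\beta_1),\dots,(z_{t_0},\beta_{t_0})$ with observed responses and an estimate $\hat\theta_{t_0}$. For $t=t_0+1,\dots,T$: let $H_{t-1}(\theta)=\sum_{s=1}^{t-1}\dot\mu(\beta_s\theta^\top z_s)\beta_s^2z_sz_s^\top$; choose $(z_t,\beta_t)\in\arg\max_{z\in\mathcal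 Z,\ \beta\in\mathcal B_{k(z)}}\det\big[H_{t-1}(\hat\theta_{t-1})+\dot\mu(\beta\hat\theta_{t-1}^\top z)\beta^2zz^\top\big]$ (ties broken at random); observe $y_t$, which conditionally on the past and on $(z_t,\beta_t)$ is Bernoulli with success probability $\mu(\beta_t\theta_*^\top z_t)$; set $\hat\theta_t=\arg\max_{\theta\in\Theta}L_t(\theta)$ where $L_t(\theta)=\frac1t\sum_{s=1}^t\{y_s\log\mu(\beta_s\theta^\top z_s)+(1-y_s)\log[1-\mu(\beta_s\theta^\top z_s)]\}$. Output $\hat\theta_T$. $H_T(\theta)$ is defined by the same formula with sum up to $T$. Designs: a design $\xi$ is a probability measure on pairs $(z,\beta)$ with $z\in\mathcal Z$, $\beta\in\mathcal B_{k(z)}$, with information matrix $M(\xi,\theta)=\sum_{(z,\beta)}\xi(z,\beta)\dot\mu(\beta\theta^\top z)\beta^2zz^\top$. $\xi_T$ is the empirical measure of $(z_1,\beta_1),\dots,(z_T,\beta_T)$, so $M(\xi_T,\theta)=\frac1TH_T(\theta)$; $\xi_*$ is a $D$-optimal design, i.e. a maximizer of $\det M(\xi,\theta_* )$ over all designs. The initial pairs are such that $M(\xi_{t_0},\theta)$ is positive definite for every $\theta\in\Theta$. Assumption 1: $M(\xi_*,\theta_* )$ is positive definite. Assumption 2: there are constants $C_\theta,C_\beta,C_\phi>0$ with $\|\theta\|_2\le C_\theta$ for all $\theta\in\Theta$, $|\beta|<C_\beta$ for all $\beta\in\mathcal B$, $\|\phi(x,a)\|_2\le C_\phi$ for all $(x,a)$;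 and $\theta_*$ is identifiable. *)

(* Defs.v *)
From HB Require Import structures.
From mathcomp Require Import all_boot all_order all_algebra.
From mathcomp Require Import all_classical all_reals all_analysis.
Set Implicit Arguments. Unset Strict Implicit. Unset Printing Implicit Defensive.
Import Order.TTheory GRing.Theory Num.Theory.
Import numFieldNormedType.Exports.
Local Open Scope classical_set_scope.
Local Open Scope ring_scope.

Section DualActive.
Variable R : realType.

Definition sigmoid (w : R) : R := (1 + expR (- w))^-1.
Definition dsigmoid (w : R) : R := sigmoid w * (1 - sigmoid w).

Definition dotv (d : nat) (u v : 'rV[R]_d) : R := (u *m v^T) 0 0.
Definition norm2 (d : nat) (v : 'rV[R]_d) : R := Num.sqrt (\sum_i v 0 i ^+ 2).

Definition posdef (d : nat) (A : 'M[R]_d) : Prop :=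
  A^T = A /\ forall v : 'rV[R]_d, v != 0 -> 0 < (v *m A *m v^T) 0 0.

Definition info (d : nat) (theta z : 'rV[R]_d) (beta : R) : 'M[R]_d :=
  (dsigmoid (beta * dotv theta z) * beta ^+ 2) *: (z^T *m z).

Definition zcand (X A : Type) (d n : nat) (phi : X -> A -> 'rV[R]_d)
  (x : 'I_n -> X) (a0 a1 : 'I_n -> A) (i : 'I_n) : 'rV[R]_d :=
  phi (x i) (a1 i) - phi (x i) (a0 i).

Definition is_design (T : finType) (xi : T -> R) : Prop :=
  (forall p, 0 <= xi p) /\ \sum_p xi p = 1.

Definition infoM (T : finType) (d : nat) (zof : T -> 'rV[R]_d) (bof : T -> R)
  (xi : T -> R) (theta : 'rV[R]_d) : 'M[R]_d :=
  \sum_p xi p *: info theta (zof p) (bof p).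

Definition empirical (T : finType) (q : nat -> T) (N : nat) : T -> R :=
  fun p => (#|[set s : 'I_N | q s == p]|)%:R / N%:R.

Definition Hmat (T : finType) (d : nat) (zof : T -> 'rV[R]_d) (bof : T -> R)
  (q : nat -> T) (theta : 'rV[R]_d) (N : nat) : 'M[R]_d :=
  \sum_(s < N) info theta (zof (q s)) (bof (q s)).

Definition loglik (T : finType) (d : nat) (zof : T -> 'rV[R]_d) (bof : T -> R)
  (q : nat -> T) (y : nat -> bool) (theta : 'rV[R]_d) (N : nat) : R :=
  N%:R^-1 * \sum_(s < N)
    ((y s)%:R * ln (sigmoid (bof (q s) * dotv theta (zof (q s))))
     + (1 - (y s)%:R) * ln (1 - sigmoid (bof (q s) * dotv theta (zof (q s))))).

Definition identifiable (T : finType) (d : nat) (zof : T -> 'rV[R]_d) (bof : T -> R)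
  (Theta : set 'rV[R]_d) (thstar : 'rV[R]_d) : Prop :=
  forall theta, Theta theta ->
    (forall p, sigmoid (bof p * dotv theta (zof p)) =
               sigmoid (bof p * dotv thstar (zof p))) -> theta = thstar.

(** responses: conditionally on the past (all earlier pairs and responses)
    and on the current pair q_t, y_t is Bernoulli(prob q_t). *)
Definition cond_bernoulli (disp : measure_display) (Omega : measurableType disp)
  (P : probability Omega R) (T : finType) (q : nat -> Omega -> T)
  (y : nat -> Omega -> bool) (prob : T -> R) : Prop :=
  forall (t : nat) (hq : nat -> T) (hy : nat -> bool),
    let E := [set w | (forall s, (s <= t)%N -> q s w = hq s) /\
                      (forall s, (s < t)%N -> y s w = hy s)] in
    P (E `&` [set w | y t w]) = ((prob (hq t))%:E * P E)%E.

End DualActive.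

(* Main.v *)
(* A martingale argument gives the law of large numbers for the residuals of
   each query pair: the second moment of the residual sum at time t is at most
   t, so along perfect squares the averages are square summable.

   The log-likelihood ratio of the MLE against the true parameter theta0 is then o(1) minus the
   average Kullback-Leibler divergence, hence theta_t - theta0 is small in
   the quadratic form M(xi_t, theta0).  This controls every logit shift because
   the leverages w_p z_p M(xi_t, theta0)^-1 z_p^T stay bounded: whatever the
   estimates in the bounded set Theta, the greedy choice is within a constant
   factor of the largest leverage, and by concavity of log det that leverage is
   at least d + delta_t, where delta_t = log det M* - log det M(xi_t, theta0);
   so det cannot decrease once delta_t is large.

   As theta_t -> theta0, the greedy choice becomes asymptotically the exact one,
   which gives t delta_{t+1} <= (t - 1) delta_t + o(1), hence delta_t -> 0.
   Finally the Kiefer-Wolfowitz condition tr(M*^-1 M) <= d turns delta_t -> 0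
   into M(xi_t, theta0) -> M*, by the equality case of
   tr C - d - log det C >= 0, proved by induction on Schur complements. *)

Require Import Defs.
From HB Require Import structures.
From mathcomp Require Import all_boot all_order all_algebra.
From mathcomp Require Import all_classical all_reals all_analysis.
From mathcomp Require Import measurable_realfun ring lra zify.
Import Order.TTheory GRing.Theory Num.Theory.
Import numFieldNormedType.Exports.
Local Open Scope classical_set_scope.
Local Open Scope ring_scope.
Set Implicit Arguments. Unset Strict Implicit. Unset Printing Implicit Defensive.

(** * Positive definite matrices *)

Definition qform {R : realType} {d} (A : 'M[R]_d) (v : 'rV[R]_d) : R :=
  (v *m A *m v^T) 0 0.

Section Posdef.
Context {R : realType}.
Implicit Types d : nat.

Lemma mx11_tr (x : 'M[R]_1) : x^T = x.
Proof. by apply/matrixP => i j; rewrite mxE !ord1. Qed.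

Lemma qform_ge0 d (A : 'M[R]_d) v : posdef A -> 0 <= qform A v.
Proof.
move=> [_ A_gt0]; have [->|v0] := eqVneq v 0.
  by rewrite /qform !mul0mx mxE.
exact/ltW/A_gt0.
Qed.

Lemma qformD d (A B : 'M[R]_d) v : qform (A + B) v = qform A v + qform B v.
Proof. by rewrite /qform mulmxDr mulmxDl mxE. Qed.

Lemma qformZ d c (A : 'M[R]_d) v : qform (c *: A) v = c * qform A v.
Proof. by rewrite /qform -scalemxAr -scalemxAl mxE. Qed.

Lemma qform_sum d (I : Type) (r : seq I) (P : pred I) (F : I -> 'M[R]_d) v :
  qform (\sum_(i <- r | P i) F i) v = \sum_(i <- r | P i) qform (F i) v.
Proof.
by rewrite /qform mulmx_sumr mulmx_suml summxE.
Qed.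

Lemma qform_rank1 d (z v : 'rV[R]_d) : qform (z^T *m z) v = dotv v z ^+ 2.
Proof.
rewrite /qform /dotv mulmxA -mulmxA mxE big_ord1 expr2; congr (_ * _).
by rewrite -[z *m v^T]trmxK trmx_mul trmxK mx11_tr.
Qed.

Lemma dotvBl d (u v z : 'rV[R]_d) : dotv (u - v) z = dotv u z - dotv v z.
Proof. by rewrite /dotv mulmxBl !mxE. Qed.

Lemma posdefD_rank1 d (A : 'M[R]_d) c (z : 'rV[R]_d) :
  0 <= c -> posdef A -> posdef (A + c *: (z^T *m z)).
Proof.
move=> c0 [As Ap]; split.
  by rewrite linearD linearZ /= As trmx_mul trmxK.
move=> v v0; rewrite -/(qform _ _) qformD qformZ qform_rank1.
by apply: ltr_wpDr (Ap v v0); rewrite mulr_ge0// sqr_ge0.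
Qed.

Lemma posdefZ d (A : 'M[R]_d) c : 0 < c -> posdef A -> posdef (c *: A).
Proof.
move=> c0 [As Ap]; split; first by rewrite linearZ /= As.
by move=> v v0; rewrite -/(qform _ _) qformZ mulr_gt0//; exact: Ap.
Qed.

Lemma posdef_congr d (A L : 'M[R]_d) :
  L \in unitmx -> posdef A -> posdef (L *m A *m L^T).
Proof.
move=> uL [As Ap]; split.
  by rewrite !trmx_mul trmxK As mulmxA.
move=> v v0; have vL0 : v *m L != 0.
  apply: contra v0 => /eqP vL0; rewrite -(mulmx1 v) -(mulmxV uL) mulmxA vL0.
  by rewrite mul0mx.
by have := Ap _ vL0; rewrite trmx_mul !mulmxA.
Qed.

(** Schur complement of the top left entry. The transpose of the upper right block stands for the
    lower left one, so the formula is meant for symmetric matrices. *)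
Definition schur d (A : 'M[R]_(1 + d)) : 'M[R]_d :=
  drsubmx A - (A 0 0)^-1 *: ((ursubmx A)^T *m ursubmx A).

Definition schur_elim d (A : 'M[R]_(1 + d)) : 'M[R]_(1 + d) :=
  block_mx 1%:M 0 (- (A 0 0)^-1 *: (ursubmx A)^T) 1%:M.

Lemma posdef_corner d (A : 'M[R]_(1 + d)) : posdef A -> 0 < A 0 0.
Proof.
move=> [_ Ap]; have := Ap (delta_mx 0 0) _.
rewrite -rowE trmx_delta -colE !mxE; apply.
by apply/eqP => /matrixP/(_ 0 0)/eqP; rewrite !mxE eqxx oner_eq0.
Qed.

Lemma posdef_blocks d (A : 'M[R]_(1 + d)) : posdef A ->
  A = block_mx (A 0 0)%:M (ursubmx A) (ursubmx A)^T (drsubmx A).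
Proof.
move=> [As _]; rewrite -[LHS]submxK; congr block_mx.
  by apply/matrixP => i j; rewrite !ord1 !mxE eqxx; congr (A _ _); apply: val_inj.
by rewrite trmx_ursub As.
Qed.

Lemma schur_elim_unit d (A : 'M[R]_(1 + d)) : schur_elim A \in unitmx.
Proof. by rewrite unitmxE det_lblock !det1 mulr1 unitr1. Qed.

Lemma schur_elimP d (A : 'M[R]_(1 + d)) : posdef A ->
  schur_elim A *m A *m (schur_elim A)^T = block_mx (A 0 0)%:M 0 0 (schur A).
Proof.
move=> Ap; have a0 := lt0r_neq0 (posdef_corner Ap).
have AE := posdef_blocks Ap.
rewrite {2}AE /schur_elim tr_block_mx !mulmx_block !trmx1 !trmx0.
rewrite !mul1mx !mul0mx !mulmx1 !mulmx0 !addr0 linearZ /= trmxK.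
have -> : - (A 0 0)^-1 *: (ursubmx A)^T *m (A 0 0)%:M + (ursubmx A)^T = 0.
  rewrite mul_mx_scalar scalerA mulrN divff// scaleN1r addrC subrr//.
rewrite mul0mx add0r mul_scalar_mx scalerA mulrN divff// scaleN1r addrC subrr.
congr block_mx; by rewrite /schur -scalemxAl scaleNr addrC.
Qed.

Lemma schur_posdef d (A : 'M[R]_(1 + d)) : posdef A -> posdef (schur A).
Proof.
move=> Ap; have [] := posdef_congr (schur_elim_unit A) Ap.
rewrite (schur_elimP Ap) => S1 S2; split.
  move: S1; rewrite tr_block_mx => /eq_block_mx[_ _ _].
  exact.
move=> v v0; have := S2 (row_mx 0 v) _.
rewrite tr_row_mx mul_row_block mul_row_col trmx0 !mulmx0 !add0r; apply.
by apply: contra v0; rewrite -row_mx0 => /eqP/eq_row_mx[_ ->].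
Qed.

Lemma schur_det d (A : 'M[R]_(1 + d)) : posdef A -> \det A = A 0 0 * \det (schur A).
Proof.
move=> Ap; have := congr1 determinant (schur_elimP Ap).
by rewrite !det_mulmx det_tr det_lblock !det1 !mul1r mulr1 det_ublock det_scalar1.
Qed.

(** By induction on the size: [schur_elim] splits off the corner entry, which is scaled to 1, and
    the induction hypothesis whitens the Schur complement. *)
Lemma cholesky d (A : 'M[R]_d) : posdef A ->
  exists2 L, L \in unitmx & L *m A *m L^T = 1%:M.
Proof.
elim: d A => [|d IH]; [move=> A Ap|rewrite -[d.+1]/(1 + d)%N => A Ap].
  by exists 1%:M; [exact: unitmx1|apply/matrixP; case].
have [L uL LE] := IH _ (schur_posdef Ap).
have a0 := posdef_corner Ap.
pose D : 'M[R]_(1 + d) := block_mx (Num.sqrt (A 0 0))^-1%:M 0 0 L.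
exists (D *m schur_elim A).
  rewrite unitmx_mul schur_elim_unit andbT unitmxE /D det_ublock det_scalar1.
  by rewrite unitrM -unitmxE uL andbT unitfE invr_eq0 sqrtr_eq0 -ltNge.
rewrite trmx_mul !mulmxA -(mulmxA D) -(mulmxA D) (schur_elimP Ap).
rewrite /D tr_block_mx !mulmx_block !trmx0 !mul0mx !mulmx0 !addr0 !add0r LE.
rewrite tr_scalar_mx -!scalar_mxM scalar_mx_block; rewrite !mul0mx.
congr (block_mx _%:M _ _ _).
by rewrite mulrAC -invfM -expr2 sqr_sqrtr ?(ltW a0)// mulVf// lt0r_neq0.
Qed.

Lemma posdef_det_gt0 d (A : 'M[R]_d) : posdef A -> 0 < \det A.
Proof.
move=> /cholesky[L uL /(congr1 determinant)]; rewrite !det_mulmx det_tr det1.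
rewrite mulrAC -expr2 => LE; move: uL; rewrite unitmxE unitfE => L0.
have L2 : 0 < \det L ^+ 2 by rewrite exprn_even_gt0//= L0.
by rewrite -(pmulr_rgt0 _ L2) LE.
Qed.

Lemma posdef_unit d (A : 'M[R]_d) : posdef A -> A \in unitmx.
Proof. by move=> /posdef_det_gt0 A0; rewrite unitmxE unitfE lt0r_neq0. Qed.

(** The bordered matrix [B] factors both as lower times upper and as upper times lower block
    triangular; the two products give the two sides. *)
Lemma det1D_rank1 d (u : 'cV[R]_d) (v : 'rV[R]_d) :
  \det (1%:M + u *m v) = 1 + (v *m u) 0 0.
Proof.
pose B : 'M[R]_(1 + d) := block_mx 1%:M (- v) u 1%:M.
have -> : \det (1%:M + u *m v) = \det B.
  have -> : B = block_mx 1%:M 0 u 1%:M *m block_mx 1%:M (- v) 0 (1%:M + u *m v).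
    rewrite mulmx_block !(mul1mx, mul0mx, mulmx1, mulmx0, addr0, add0r) mulmxN.
    by congr block_mx; rewrite [1%:M + _]addrC addKr.
  by rewrite det_mulmx det_lblock det_ublock !det1 !mul1r.
have -> : B = block_mx (1%:M + v *m u) (- v) 0 1%:M *m block_mx 1%:M 0 u 1%:M.
  rewrite mulmx_block !(mul1mx, mul0mx, mulmx1, mulmx0, addr0, add0r) mulNmx.
  by congr block_mx; rewrite addrK.
by rewrite det_mulmx det_lblock det_ublock !det1 !mulr1 det_mx11 !mxE eqxx.
Qed.

(** The matrix determinant lemma. It turns the greedy determinant criterion into a comparison of
    leverages. *)
Lemma det_rank1 d (A : 'M[R]_d) c (z : 'rV[R]_d) : A \in unitmx ->
  \det (A + c *: (z^T *m z)) = \det A * (1 + c * qform (invmx A) z).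
Proof.
move=> uA; have -> : A + c *: (z^T *m z) =
    A *m (1%:M + (c *: (invmx A *m z^T)) *m z).
  by rewrite mulmxDr mulmx1 -scalemxAl -scalemxAr !mulmxA mulmxV// mul1mx.
by rewrite det_mulmx det1D_rank1 -scalemxAr mxE mulmxA.
Qed.

Lemma cauchy_schwarz_posdef d (A : 'M[R]_d) (u v : 'rV[R]_d) : posdef A ->
  (v *m A *m u^T) 0 0 ^+ 2 <= qform A v * qform A u.
Proof.
move=> Ap; have [->|u0] := eqVneq u 0.
  by rewrite /qform trmx0 !mulmx0 mxE expr0n/= mulr0.
have U : 0 < qform A u by exact: Ap.2.
(* This [t] minimizes [qform A (v - t *: u)]. *)
set b := (v *m A *m u^T) 0 0; set t := b / qform A u.
have := qform_ge0 (v - t *: u) Ap.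
have -> : qform A (v - t *: u) = qform A v - t * b - t * b + t ^+ 2 * qform A u.
  pose f (v1 v2 : 'rV[R]_d) := (v1 *m A *m v2^T) 0 0 : R.
  have f_sym v1 v2 : f v1 v2 = f v2 v1.
    by rewrite /f -[v1 *m A *m v2^T]mx11_tr !trmx_mul trmxK Ap.1 mulmxA.
  have fBZ v1 v2 v3 : f (v1 - t *: v2) v3 = f v1 v3 - t * f v2 v3.
    by rewrite /f !mulmxBl -!scalemxAl !mxE.
  rewrite -[LHS]/(f _ _) fBZ ![f _ (v - _)]f_sym !fBZ [f u v]f_sym.
  rewrite -[f v v]/(qform A v) -[f u u]/(qform A u) -[f v u]/b; ring.
rewrite /t; have Uu := lt0r_neq0 U.
rewrite (_ : _ + _ = (qform A v * qform A u - b ^+ 2) / qform A u); last by field.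
by rewrite pmulr_lge0 ?invr_gt0// subr_ge0.
Qed.

Lemma invmx_sym d (A : 'M[R]_d) : A^T = A -> (invmx A)^T = invmx A.
Proof. by move=> As; rewrite trmx_inv As. Qed.

Lemma qform_invmx d (A : 'M[R]_d) z : posdef A ->
  qform A (z *m invmx A) = qform (invmx A) z.
Proof.
move=> Ap; rewrite /qform mulmxKV ?posdef_unit// trmx_mul invmx_sym ?mulmxA//.
exact: Ap.1.
Qed.

Lemma qform_invmx_ge0 d (A : 'M[R]_d) z : posdef A -> 0 <= qform (invmx A) z.
Proof. by move=> Ap; rewrite -qform_invmx// qform_ge0. Qed.

(** Cauchy-Schwarz in the form [A], for [v] and [z *m invmx A]. A small quadratic form and a bounded
    leverage thus give a small logit shift. *)
Lemma dotv_sq_le d (A : 'M[R]_d) (v z : 'rV[R]_d) : posdef A ->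
  dotv v z ^+ 2 <= qform A v * qform (invmx A) z.
Proof.
move=> Ap; rewrite -qform_invmx//; apply: le_trans (cauchy_schwarz_posdef _ _ Ap).
rewrite trmx_mul invmx_sym ?(proj1 Ap)// mulmxA mulmxK ?posdef_unit//.
Qed.

(** Inversion reverses the order of quadratic forms: [dotv_sq_le] at [z *m invmx B] gives
    [b ^+ 2 <= r * b * qform (invmx A) z], and one factor [b] cancels. *)
Lemma qform_invmx_le d (A B : 'M[R]_d) (r : R) z : posdef A -> posdef B ->
  (forall v, qform A v <= r * qform B v) ->
  qform (invmx B) z <= r * qform (invmx A) z.
Proof.
move=> Ap Bp AB; set b := qform (invmx B) z.
have a0 := qform_invmx_ge0 z Ap; have b0 : 0 <= b := qform_invmx_ge0 z Bp.
have := dotv_sq_le (z *m invmx B) z Ap; rewrite [dotv _ _]/dotv -/(qform _ _) -/b.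
move=> /le_trans/(_ (ler_wpM2r a0 (AB _))); rewrite qform_invmx// -/b.
(* If [b = 0] nothing can be cancelled; for nonzero [z], comparing the two forms at [z] shows that
   [r] is positive. *)
have [->|bn0] := eqVneq b 0.
  move=> _; have [->|zn0] := eqVneq z 0; first by rewrite /qform !mul0mx mxE mulr0.
  have A1 : 0 < qform A z by apply: Ap.2.
  have B1 : 0 < qform B z by apply: Bp.2.
  have r0 : 0 < r by rewrite -(pmulr_lgt0 _ B1); exact: lt_le_trans (AB z).
  by rewrite mulr_ge0// ltW.
have {}b0 : 0 < b by rewrite lt_neqAle eq_sym bn0.
by rewrite expr2 [r * b]mulrC -mulrA ler_pM2l.
Qed.

Lemma trace_mul_rank1 d (K : 'M[R]_d) (z : 'rV[R]_d) :
  \tr (K *m (z^T *m z)) = qform K z.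
Proof. by rewrite mulmxA mxtrace_mulC mulmxA /qform trace_mx11. Qed.

(** For positive definite [C], the sum of [c - 1 - ln c] over its eigenvalues: twice the
    Kullback-Leibler divergence between centred Gaussians of covariances [C] and 1. *)
Definition logdet_gap d (C : 'M[R]_d) : R := \tr C - d%:R - ln (\det C).

(** All three summands are nonnegative, so a small gap forces the corner towards 1, the rest of the
    first row towards 0, and leaves a small gap for the Schur complement. *)
Lemma logdet_gap_schur d (C : 'M[R]_(1 + d)) : posdef C ->
  logdet_gap C = (C 0 0 - 1 - ln (C 0 0))
    + (C 0 0)^-1 * (\sum_j C 0 (rshift 1 j) ^+ 2) + logdet_gap (schur C).
Proof.
move=> Cp; have c0 := posdef_corner Cp.
have S0 := posdef_det_gt0 (schur_posdef Cp).
rewrite /logdet_gap schur_det// lnM ?posrE// /schur raddfB /= mxtraceZ.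
rewrite mxtrace_mulC trace_mx11.
have -> : (ursubmx C *m (ursubmx C)^T) 0 0 = \sum_j C 0 (rshift 1 j) ^+ 2.
  rewrite mxE; apply: eq_bigr => j _; rewrite !mxE expr2.
  by rewrite (_ : lshift d 0 = 0)//; apply: val_inj.
have -> : \tr C = C 0 0 + \tr (drsubmx C).
  rewrite {1}(posdef_blocks Cp) mxtrace_block; congr (_ + _).
  by rewrite trace_mx11 mxE eqxx.
rewrite natrD; ring.
Qed.

(** With [s] the square root of [c], [ln c = 2 * ln s <= 2 * (s - 1)], and [c - 1 - 2 * (s - 1)] is
    the square of [s - 1]. *)
Lemma ln_le_sqrt (c : R) : 0 < c -> (Num.sqrt c - 1) ^+ 2 <= c - 1 - ln c.
Proof.
move=> c0; have s0 : 0 < Num.sqrt c by rewrite sqrtr_gt0.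
have -> : ln c = ln (Num.sqrt c) + ln (Num.sqrt c).
  by rewrite -lnM ?posrE// -expr2 sqr_sqrtr// ltW.
have lns : ln (Num.sqrt c) <= Num.sqrt c - 1.
  by rewrite -{1}[Num.sqrt c](subrK 1) addrC; apply: le_ln1Dx; lra.
have cE : c = Num.sqrt c ^+ 2 by rewrite sqr_sqrtr// ltW.
rewrite {2}cE; nra.
Qed.

Lemma logdet_gap_ge0 d (C : 'M[R]_d) : posdef C -> 0 <= logdet_gap C.
Proof.
elim: d C => [|d IH]; [move=> C Cp|rewrite -[d.+1]/(1 + d)%N => C Cp].
  by rewrite /logdet_gap /mxtrace big_ord0 det_mx00 ln1 subr0 subrr.
have c0 := posdef_corner Cp; have S0 := IH _ (schur_posdef Cp).
have V0 : 0 <= (C 0 0)^-1 * (\sum_j C 0 (rshift 1 j) ^+ 2).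
  by rewrite mulr_ge0 ?invr_ge0 ?(ltW c0)// sumr_ge0// => j _; exact: sqr_ge0.
have := le_trans (sqr_ge0 _) (ln_le_sqrt c0); rewrite (logdet_gap_schur Cp); lra.
Qed.

(** A quantitative equality case. Each Schur step adds at most [3 * e] to the entrywise error, which
    explains the factor [3 * d%:R]. *)
Lemma logdet_gap_near1 d (C : 'M[R]_d) : posdef C -> logdet_gap C <= 1 ->
  forall i j, `|C i j - (i == j)%:R| <= 3 * d%:R * Num.sqrt (logdet_gap C).
Proof.
elim: d C => [|d IH]; [by move=> C _ _ []|rewrite -[d.+1]/(1 + d)%N => C Cp].
have c0 := posdef_corner Cp; have Sp := schur_posdef Cp.
have S0 := logdet_gap_ge0 Sp; have g0 := logdet_gap_ge0 Cp.
have gE := logdet_gap_schur Cp; have := ln_le_sqrt c0.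
set s := Num.sqrt (C 0 0) => c1 g1.
have s0 : 0 < s by rewrite sqrtr_gt0.
have cE : C 0 0 = s ^+ 2 by rewrite sqr_sqrtr// ltW.
set e := Num.sqrt (logdet_gap C).
have e0 : 0 <= e by exact: sqrtr_ge0.
have eE : logdet_gap C = e ^+ 2 by rewrite sqr_sqrtr.
have e1 : e <= 1 by rewrite -sqrtr1 ler_wsqrtr.
set V := \sum_j _ in gE.
have V0 : 0 <= (C 0 0)^-1 * V.
  by rewrite mulr_ge0 ?invr_ge0 ?(ltW c0)// sumr_ge0// => j _; exact: sqr_ge0.
have s1 : `|s - 1| <= e.
  rewrite -(ler_pXn2r (n := 2)) ?nnegrE// -eE real_normK ?num_real//; lra.
have s2 : s <= 2 by move: s1; rewrite ler_norml => /andP[]; lra.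
have vle j : (C 0 0)^-1 * C 0 (rshift 1 j) ^+ 2 <= e ^+ 2.
  rewrite -eE gE; apply: (@le_trans _ _ ((C 0 0)^-1 * V)); last first.
    by have := sqr_ge0 (s - 1); lra.
  rewrite ler_wpM2l ?invr_ge0 ?(ltW c0)// /V (bigD1 j)//= lerDl sumr_ge0// => k _.
  exact: sqr_ge0.
have vle2 j : `|C 0 (rshift 1 j)| <= 2 * e.
  rewrite -(ler_pXn2r (n := 2)) ?nnegrE ?mulr_ge0// real_normK ?num_real//.
  have := vle j; rewrite mulrC ler_pdivrMr// => /le_trans; apply.
  rewrite cE; nra.
have SC : forall i j, `|schur C i j - (i == j)%:R| <= 3 * d%:R * e.
  move=> i j; apply: le_trans (IH _ Sp _ i j) _.
    by move: g1; rewrite gE; have := sqr_ge0 (s - 1); lra.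
  rewrite ler_wpM2l ?mulr_ge0// ler_wsqrtr// gE; have := sqr_ge0 (s - 1); lra.
have de : 0 <= d%:R * e :> R by rewrite mulr_ge0.
have row_le j : `|C 0 (rshift 1 j)| <= 3 * (1 + d)%:R * e.
  by apply: le_trans (vle2 j) _; rewrite natrD; lra.
have o0 (k : 'I_1) : lshift d k = 0 by apply: val_inj; rewrite ord1.
move=> i j; case: (split_ordP i) => k ->; case: (split_ordP j) => l ->.
(* The corner error is [(s - 1) * (s + 1)] with [s <= 2]: the source of the constant 3. *)
- rewrite !o0 eqxx mulr1n cE natrD.
  rewrite (_ : s ^+ 2 - _ = (s - 1) * (s + 1)); last by ring.
  rewrite normrM (ger0_norm (_ : 0 <= s + 1)); last by lra.
  have := normr_ge0 (s - 1); nra.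
- by rewrite o0 (_ : (0 == _) = false)// subr0.
- rewrite o0 (_ : (_ == 0) = false)// subr0.
  by rewrite -[C]Cp.1 mxE.
have -> : C (rshift 1 k) (rshift 1 l) - (rshift 1 k == rshift 1 l)%:R =
    (schur C k l - (k == l)%:R) + (C 0 0)^-1 * (C 0 (rshift 1 k) * C 0 (rshift 1 l)).
  by rewrite (inj_eq (@rshift_inj _ _)) /schur !mxE big_ord1 !mxE !o0; ring.
apply: le_trans (ler_normD _ _) _.
(* The rank-one correction is at most [e ^+ 2] by [vle] and the arithmetic-geometric mean
   inequality, hence at most [e]. *)
have : `|(C 0 0)^-1 * (C 0 (rshift 1 k) * C 0 (rshift 1 l))| <= e.
  have c'0 : 0 < (C 0 0)^-1 by rewrite invr_gt0.
  have := vle k; have := vle l; move: (C 0 (rshift 1 k)) (C 0 (rshift 1 l)) => u v.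
  set c' := (C 0 0)^-1 in c'0 * => hu hv.
  have h1 := mulr_ge0 (ltW c'0) (sqr_ge0 (u - v)).
  have h2 := mulr_ge0 (ltW c'0) (sqr_ge0 (u + v)).
  have ee : e ^+ 2 <= e by rewrite expr2; nra.
  rewrite ler_norml; apply/andP; split; nra.
have := SC k l; rewrite natrD; lra.
Qed.

(** As [L^T *m L] is the inverse of [A], the gap of the whitened [B] is the first-order Taylor error
    of log det at [A]. *)
Lemma logdet_gap_congr d (A B L : 'M[R]_d) : posdef A -> posdef B ->
  L *m A *m L^T = 1%:M ->
  logdet_gap (L *m B *m L^T) =
    \tr (invmx A *m B) - d%:R - (ln (\det B) - ln (\det A)).
Proof.
move=> Ap Bp LE; have A0 := posdef_det_gt0 Ap; have B0 := posdef_det_gt0 Bp.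
have LL : L^T *m L = invmx A.
  have ALL : A *m (L^T *m L) = 1%:M.
    by rewrite mulmxA; apply: mulmx1C; rewrite mulmxA.
  by rewrite -[LHS](mulKmx (posdef_unit Ap)) ALL mulmx1.
rewrite /logdet_gap mxtrace_mulC mulmxA LL; congr (_ - _).
rewrite -ln_div ?posrE//; congr ln.
move: LE => /(congr1 determinant); rewrite !det_mulmx !det_tr det1 => LE.
have -> : \det L * \det B * \det L = (\det L * \det A * \det L) * (\det B / \det A).
  by field; exact: lt0r_neq0.
by rewrite LE mul1r.
Qed.

Lemma logdet_concave d (A B : 'M[R]_d) : posdef A -> posdef B ->
  d%:R + (ln (\det B) - ln (\det A)) <= \tr (invmx A *m B).
Proof.
move=> Ap Bp; have [L uL LE] := cholesky Ap.
have := logdet_gap_ge0 (posdef_congr uL Bp).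
by rewrite (logdet_gap_congr Ap Bp LE); lra.
Qed.

Lemma logdet_concave_near d (A : 'M[R]_d) : posdef A ->
  exists2 K : R, 0 <= K & forall B, posdef B -> forall g,
    \tr (invmx A *m B) - d%:R - (ln (\det B) - ln (\det A)) <= g -> g <= 1 ->
    forall i j, `|B i j - A i j| <= K * Num.sqrt g.
Proof.
move=> Ap; have [L uL LE] := cholesky Ap.
(* Undoing the whitening gives [B - A = P *m (C - 1%:M) *m P^T]; [N] bounds every absolute row sum
   of [P]. *)
pose P := invmx L; pose N := \sum_i \sum_j `|P i j|.
have N0 : 0 <= N by apply: sumr_ge0 => i _; exact: sumr_ge0.
have rowN i : \sum_j `|P i j| <= N.
  rewrite /N [leRHS](bigD1 i)//= lerDl; apply: sumr_ge0 => k _; exact: sumr_ge0.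
exists (N * N * (3 * d%:R)); first by rewrite !mulr_ge0.
move=> B Bp g gB g1 i j; set C := L *m B *m L^T.
have gE := logdet_gap_congr Ap Bp LE.
have Cn k l : `|(C - 1%:M) k l| <= 3 * d%:R * Num.sqrt g.
  have := logdet_gap_near1 (posdef_congr uL Bp); rewrite gE.
  move=> /(_ (le_trans gB g1) k l); rewrite !mxE => /le_trans; apply.
  by rewrite ler_wpM2l ?mulr_ge0// ler_wsqrtr.
have -> : B i j - A i j = (P *m (C - 1%:M) *m P^T) i j.
  transitivity ((B - A) i j); first by rewrite !mxE.
  congr (fun_of_matrix _ i j); rewrite /C -LE -mulmxBl -mulmxBr.
  rewrite /P !mulmxA mulVmx// mul1mx -mulmxA -trmx_mul mulVmx//.
  by rewrite trmx1 mulmx1.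
rewrite mxE; apply: le_trans (ler_norm_sum _ _ _) _.
set m := 3 * d%:R * Num.sqrt g in Cn.
have m0 : 0 <= m by rewrite !mulr_ge0 ?sqrtr_ge0.
apply: (@le_trans _ _ (\sum_k (N * m) * `|P j k|)).
  apply: ler_sum => k _; rewrite [P^T _ _]mxE normrM ler_wpM2r// mxE.
  apply: le_trans (ler_norm_sum _ _ _) _.
  apply: (@le_trans _ _ (\sum_l `|P i l| * m)).
    by apply: ler_sum => l _; rewrite normrM ler_wpM2l.
  by rewrite -mulr_suml ler_wpM2r.
rewrite -mulr_sumr (_ : _ * _ * _ * _ = N * m * N); last by rewrite /m; ring.
by rewrite ler_wpM2l ?mulr_ge0.
Qed.

End Posdef.

(** * The logistic link *)

Section Sigmoid.
Context {R : realType}.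
Implicit Types w v a b : R.

Lemma sigmoid_gt0 w : 0 < sigmoid w.
Proof. by rewrite invr_gt0 addr_gt0// expR_gt0. Qed.

Lemma sigmoid_lt1 w : sigmoid w < 1.
Proof. by rewrite invf_lt1 ?ltrDl ?addr_gt0// expR_gt0. Qed.

Lemma logit_sigmoid w : ln (sigmoid w) - ln (1 - sigmoid w) = w.
Proof.
have s0 := sigmoid_gt0 w; have s1 := sigmoid_lt1 w.
rewrite -ln_div ?posrE ?subr_gt0// -[RHS]expRK; congr ln.
rewrite -[w in RHS]opprK expRN /sigmoid; have := expR_gt0 (- w).
move: (expR (- w)) => e e0; field.
by rewrite !lt0r_neq0 ?addr_gt0//= addrC addKr lt0r_neq0.
Qed.

Lemma dsigmoidE w : dsigmoid w = (2 + expR w + expR (- w))^-1.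
Proof.
rewrite /dsigmoid /sigmoid -{3}[w]opprK (expRN (- w)); have := expR_gt0 (- w).
move: (expR (- w)) => e e0; field.
by rewrite !lt0r_neq0 ?addr_gt0//= ?mulr_gt0//.
Qed.

Lemma dsigmoid_gt0 w : 0 < dsigmoid w.
Proof. by rewrite dsigmoidE invr_gt0 !addr_gt0// expR_gt0. Qed.

(** The logarithm of [dsigmoid] is 1-Lipschitz: in [2 + expR w + expR (- w)] each term changes by at
    most the factor [expR] of the shift. *)
Lemma dsigmoid_le w v : dsigmoid w <= expR `|w - v| * dsigmoid v.
Proof.
have d0 u : 0 < 2 + expR u + expR (- u) by rewrite !addr_gt0// expR_gt0.
rewrite !dsigmoidE ler_pdivlMr// mulrC ler_pdivrMr//.
have h1 : expR v <= expR `|w - v| * expR w.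
  by rewrite -expRD ler_expR -lerBlDr distrC ler_norm.
have h2 : expR (- v) <= expR `|w - v| * expR (- w).
  by rewrite -expRD ler_expR -lerBlDr opprK addrC ler_norm.
have := expR_ge1Dx `|w - v|; have := normr_ge0 (w - v); nra.
Qed.

(** The right side is the square of [expR (w / 2) - expR (- (w / 2))], which is at least [w / 2] for
    nonnegative [w]. *)
Lemma expR_cosh_ge w : w ^+ 2 / 4 <= expR w + expR (- w) - 2.
Proof.
wlog w0 : w / 0 <= w.
  move=> H; case: (leP 0 w) => [/H//|/ltW w0].
  by have := H (- w); rewrite oppr_ge0 sqrrN opprK [expR _ + _]addrC; apply.
have := expR_ge1Dx (w / 2); have : expR (- (w / 2)) <= 1 by rewrite -[leRHS]expR0 ler_expR; lra.
have -> : expR w = expR (w / 2) ^+ 2 by rewrite expr2 -expRD; congr expR; lra.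
have -> : expR (- w) = expR (- (w / 2)) ^+ 2 by rewrite expr2 -expRD; congr expR; lra.
have : expR (w / 2) * expR (- (w / 2)) = 1 by rewrite -expRD subrr expR0.
move: (expR (w / 2)) (expR (- (w / 2))) => e f ef f1 e1; nra.
Qed.

Lemma sigmoidB_sq w v :
  (sigmoid w - sigmoid v) ^+ 2 =
  (expR (w - v) + expR (v - w) - 2) * (dsigmoid w * dsigmoid v).
Proof.
have -> : expR (w - v) = expR w / expR v by rewrite expRD expRN.
have -> : expR (v - w) = expR v / expR w by rewrite expRD expRN.
rewrite !dsigmoidE /sigmoid !expRN; have := expR_gt0 w; have := expR_gt0 v.
move: (expR w) (expR v) => e f f0 e0; field.
have h (u : R) : 0 < u -> 0 < (2 + u) * u + 1.
  by move=> u0; rewrite addr_gt0// mulr_gt0// addr_gt0.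
by rewrite !lt0r_neq0// ?h// addr_gt0.
Qed.

Definition bernoulli_kl a b : R :=
  a * (ln a - ln b) + (1 - a) * (ln (1 - a) - ln (1 - b)).

(* Bounds the divergence below by the squared Hellinger distance. *)
Lemma bernoulli_kl_ge a b : 0 < a < 1 -> 0 < b < 1 ->
  (a - b) ^+ 2 / 4 <= bernoulli_kl a b.
Proof.
have lnB (x y : R) : 0 < x -> 0 < y ->
    2 * (x - Num.sqrt x * Num.sqrt y) <= x * (ln x - ln y).
  move=> x0 y0; have sx : 0 < Num.sqrt x by rewrite sqrtr_gt0.
  have yx0 : 0 < y / x by rewrite divr_gt0.
  have := ln_le_sqrt yx0; rewrite ln_div ?posrE// sqrtrM ?(ltW y0)// sqrtrV ?(ltW x0)//.
  have sxE : Num.sqrt x ^+ 2 = x by rewrite sqr_sqrtr// ltW.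
  have syE : Num.sqrt y ^+ 2 = y by rewrite sqr_sqrtr// ltW.
  have -> : y / x = (Num.sqrt y / Num.sqrt x) ^+ 2 by rewrite expr_div_n sxE syE.
  have -> : Num.sqrt x * Num.sqrt y = x * (Num.sqrt y / Num.sqrt x).
    by rewrite -{2}sxE; field; exact: lt0r_neq0.
  move: (_ / _) => r h; rewrite (_ : 2 * _ = x * (2 - 2 * r)); last by ring.
  by rewrite ler_pM2l//; lra.
move=> /andP[a0 a1] /andP[b0 b1]; rewrite /bernoulli_kl.
have a'0 : 0 < 1 - a by rewrite subr_gt0.
have b'0 : 0 < 1 - b by rewrite subr_gt0.
have h1 := lnB _ _ a0 b0; have h2 := lnB _ _ a'0 b'0.
have := sqr_sqrtr (ltW a0); have := sqr_sqrtr (ltW b0).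
have := sqr_sqrtr (ltW a'0); have := sqr_sqrtr (ltW b'0).
have := sqrtr_ge0 a; have := sqrtr_ge0 b.
move: (Num.sqrt a) (Num.sqrt b) (Num.sqrt (1 - a)) (Num.sqrt (1 - b)) h1 h2.
move=> s t u v h1 h2 t0 s0 v2 u2 t2 s2.
have s1 : s <= 1 by nra.
have t1 : t <= 1 by nra.
(* [h1] and [h2] add up to the squared Hellinger distance [(s - t) ^+ 2 + (u - v) ^+ 2]; the factor
   4 comes from [s + t <= 2]. *)
apply: (@le_trans _ _ ((s - t) ^+ 2)).
  rewrite -s2 -t2 (_ : (s ^+ 2 - t ^+ 2) ^+ 2 = (s - t) ^+ 2 * (s + t) ^+ 2); last by ring.
  rewrite ler_pdivrMr// ler_wpM2l ?sqr_ge0//; nra.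
have := sqr_ge0 (u - v); lra.
Qed.

(** The 16 is 4 from [bernoulli_kl_ge] times 4 from [expR_cosh_ge]; [dsigmoid_le] replaces
    [dsigmoid w] by a multiple of [dsigmoid v]. *)
Lemma kl_sigmoid_ge w v :
  dsigmoid v ^+ 2 * expR (- `|w - v|) * (w - v) ^+ 2 / 16
    <= bernoulli_kl (sigmoid v) (sigmoid w).
Proof.
apply: le_trans (bernoulli_kl_ge _ _); rewrite ?sigmoid_gt0 ?sigmoid_lt1//.
rewrite sigmoidB_sq; have c := expR_cosh_ge (v - w); rewrite opprB in c.
have := dsigmoid_le v w; rewrite distrC; have v0 := dsigmoid_gt0 v.
rewrite mulrC -ler_pdivrMr ?expR_gt0// -expRN => h.
have E0 := expR_gt0 (- `|w - v|).
have -> : (w - v) ^+ 2 = (v - w) ^+ 2 by ring.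
move: (expR _ + _ - 2) c => C c; move: ((v - w) ^+ 2) (sqr_ge0 (v - w)) c => D D0 c.
have h1 : dsigmoid v * (dsigmoid v * expR (- `|w - v|)) <= dsigmoid v * dsigmoid w.
  by rewrite ler_pM2l.
have h2 : 0 <= dsigmoid v * (dsigmoid v * expR (- `|w - v|)).
  by apply: mulr_ge0; [|apply: mulr_ge0]; exact: ltW.
have : D / 4 * (dsigmoid v * (dsigmoid v * expR (- `|w - v|))) <=
  C * (dsigmoid v * dsigmoid w) by apply: ler_pM => //; lra.
lra.
Qed.

End Sigmoid.

(** * Designs and leverages *)

Section Empirical.
Context {R : realType} {T : finType}.
Implicit Types q : nat -> T.

(** Stated for a general module so as to serve both information matrices and, through [R^o], scalar
    averages. *)
Lemma empirical_sum (V : lmodType R) q N (F : T -> V) :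
  \sum_p @empirical R T q N p *: F p = N%:R^-1 *: \sum_(s < N) F (q s).
Proof.
have E p : @empirical R T q N p = \sum_(s < N) (q s == p)%:R * N%:R^-1.
  rewrite /empirical -sum1_card natr_sum mulr_suml big_mkcond /=.
  apply: eq_bigr => s _; rewrite -[s \in _]/`[<is_true (q s == p)>] asboolb.
  by case: eqP; rewrite ?mul0r.
under eq_bigr do rewrite E scaler_suml.
rewrite exchange_big scaler_sumr /=; apply: eq_bigr => s _.
rewrite (bigD1 (q s))//= eqxx mul1r big1 ?addr0// => p pq.
by rewrite eq_sym (negPf pq) mul0r scale0r.
Qed.

Lemma empirical_mean q N (f : T -> R) :
  \sum_p @empirical R T q N p * f p = N%:R^-1 * \sum_(s < N) f (q s).
Proof. exact: (@empirical_sum R^o). Qed.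

Lemma empirical_ge0 q N p : 0 <= @empirical R T q N p.
Proof. by rewrite mulr_ge0 ?invr_ge0. Qed.

Lemma empirical_design q N : (0 < N)%N -> is_design (@empirical R T q N).
Proof.
move=> N0; split; first exact: empirical_ge0.
under eq_bigr do rewrite -[empirical _ _ _]mulr1.
rewrite empirical_mean sumr_const card_ord mulVf// pnatr_eq0 -lt0n//.
Qed.

End Empirical.

Section Design.
Context {R : realType} {T : finType} {d : nat}.
Variables (z : T -> 'rV[R]_d) (b : T -> R).
Hypothesis b_gt0 : forall p, 0 < b p.
Implicit Types (xi : T -> R) (theta : 'rV[R]_d).

Definition weight theta p : R := dsigmoid (b p * dotv theta (z p)) * b p ^+ 2.

Lemma weight_gt0 theta p : 0 < weight theta p.
Proof. by rewrite mulr_gt0 ?dsigmoid_gt0 ?exprn_gt0. Qed.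

Lemma infoE theta p : info theta (z p) (b p) = weight theta p *: ((z p)^T *m z p).
Proof. by []. Qed.

Lemma qform_infoM xi theta v :
  qform (infoM z b xi theta) v = \sum_p xi p * (weight theta p * dotv v (z p) ^+ 2).
Proof.
by rewrite qform_sum; apply: eq_bigr => p _; rewrite qformZ infoE qformZ qform_rank1.
Qed.

(** The variance function of optimal design theory: the derivative of log det at [A] in the
    direction of the information of [p]. *)
Definition leverage theta (A : 'M[R]_d) p : R :=
  weight theta p * qform (invmx A) (z p).

Lemma leverage_ge0 theta A p : posdef A -> 0 <= leverage theta A p.
Proof.
by move=> Ap; rewrite /leverage; exact: mulr_ge0 (ltW (weight_gt0 _ _)) (qform_invmx_ge0 _ Ap).
Qed.

Lemma trace_infoM xi theta A :
  \tr (invmx A *m infoM z b xi theta) = \sum_p xi p * leverage theta A p.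
Proof.
rewrite mulmx_sumr raddf_sum /=; apply: eq_bigr => p _.
by rewrite infoE -!scalemxAr !mxtraceZ trace_mul_rank1.
Qed.

Lemma det_info theta A p r : A \in unitmx ->
  \det (A + r *: info theta (z p) (b p)) = \det A * (1 + r * leverage theta A p).
Proof. by move=> uA; rewrite infoE scalerA det_rank1// /leverage mulrA. Qed.

Lemma HmatE q theta N : (0 < N)%N ->
  Hmat z b q theta N = N%:R *: infoM z b (@empirical R T q N) theta.
Proof.
by move=> N0; rewrite /infoM empirical_sum scalerA divff ?scale1r// pnatr_eq0 -lt0n.
Qed.

Lemma infoM_empiricalS q theta t : (0 < t)%N ->
  infoM z b (@empirical R T q t.+1) theta =
  (1 + t%:R^-1)^-1 *: (infoM z b (@empirical R T q t) theta
                       + t%:R^-1 *: info theta (z (q t)) (b (q t))).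
Proof.
move=> t0; rewrite /infoM !empirical_sum big_ord_recr /= -scalerDr scalerA.
congr (_ *: _); have t' : t%:R != 0 :> R by rewrite pnatr_eq0 -lt0n.
by rewrite -natr1; field; rewrite t' /= lt0r_neq0 ?andbT//.
Qed.

Lemma infoM_mix xi theta p0 r : is_design xi -> 0 <= r ->
  exists2 xi', is_design xi' & infoM z b xi' theta =
    (1 + r)^-1 *: (infoM z b xi theta + r *: info theta (z p0) (b p0)).
Proof.
move=> [xi0 xi1] r0; have r1 : 0 < 1 + r by rewrite ltr_wpDr.
exists (fun p => (1 + r)^-1 * (xi p + r * (p == p0)%:R)).
  split=> [p|]; first by rewrite mulr_ge0 ?invr_ge0 ?(ltW r1)// addr_ge0// mulr_ge0.
  rewrite -mulr_sumr big_split /= xi1 -mulr_sumr (bigD1 p0)//= eqxx big1.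
    by rewrite addr0 mulr1 mulVf// lt0r_neq0.
  by move=> p /negPf ->.
rewrite /infoM; under eq_bigr do rewrite -scalerA scalerDl.
rewrite -scaler_sumr big_split /=; congr (_ *: (_ + _)).
rewrite (bigD1 p0)//= eqxx mulr1 big1 ?addr0// => p /negPf ->.
by rewrite mulr0 scale0r.
Qed.

(** The exponent sums over all pairs so that one number controls every weight at once. *)
Lemma weight_le theta theta' p :
  weight theta p <=
  expR (\sum_p b p * `|dotv (theta - theta') (z p)|) * weight theta' p.
Proof.
rewrite /weight mulrA ler_wpM2r ?sqr_ge0//.
apply: le_trans (dsigmoid_le _ (b p * dotv theta' (z p))) _.
rewrite ler_wpM2r ?(ltW (dsigmoid_gt0 _))// ler_expR.
rewrite -mulrBr -dotvBl normrM (gtr0_norm (b_gt0 p)).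
rewrite [leRHS](bigD1 p)//= lerDl sumr_ge0// => p' _.
by rewrite mulr_ge0// ltW.
Qed.

(* Comparing the criterion at [theta] with the one at [theta'] costs a factor
   [expR eta] for each of two weights and two inverse information matrices. *)
Lemma greedy_leverage (xi : T -> R) (theta theta' : 'rV[R]_d) t p0 eta :
  (forall p, 0 <= xi p) -> (0 < t)%N ->
  eta = \sum_p b p * `|dotv (theta - theta') (z p)| ->
  posdef (infoM z b xi theta) -> posdef (infoM z b xi theta') ->
  (forall p, \det (t%:R *: infoM z b xi theta + info theta (z p) (b p)) <=
             \det (t%:R *: infoM z b xi theta + info theta (z p0) (b p0))) ->
  forall p, leverage theta' (infoM z b xi theta') p <=
    expR (4 * eta) * leverage theta' (infoM z b xi theta') p0.
Proof.
move=> xi0 t0 etaE; set A := infoM _ _ _ _; set A' := infoM _ _ _ theta' => Ap A'p opt p.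
have t0' : 0 < t%:R :> R by rewrite ltr0n.
(* By [det_info] the greedy rule at [theta] maximizes the leverage at [theta]. *)
have lev : leverage theta A p <= leverage theta A p0.
  have AE r : t%:R *: A + info theta (z r) (b r) =
              t%:R *: (A + t%:R^-1 *: info theta (z r) (b r)).
    by rewrite scalerDr scalerA divff ?scale1r// lt0r_neq0.
  have := opt p; rewrite !AE !detZ ler_pM2l ?exprn_gt0//.
  rewrite !det_info ?posdef_unit// ler_pM2l ?posdef_det_gt0// lerD2l.
  by rewrite ler_pM2l// invr_gt0.
have w1 r : weight theta r <= expR eta * weight theta' r.
  by rewrite etaE; exact: weight_le.
have w2 r : weight theta' r <= expR eta * weight theta r.
  rewrite etaE (eq_bigr (fun p => b p * `|dotv (theta' - theta) (z p)|)).
    exact: weight_le.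
  by move=> r' _; rewrite !dotvBl distrC.
have q1 v : qform A v <= expR eta * qform A' v.
  rewrite !qform_infoM mulr_sumr; apply: ler_sum => r _.
  by rewrite [leRHS]mulrCA ler_wpM2l// [leRHS]mulrA ler_wpM2r// sqr_ge0.
have q2 v : qform A' v <= expR eta * qform A v.
  rewrite !qform_infoM mulr_sumr; apply: ler_sum => r _.
  by rewrite [leRHS]mulrCA ler_wpM2l// [leRHS]mulrA ler_wpM2r// sqr_ge0.
have i1 r := qform_invmx_le (z r) Ap A'p q1.
have i2 r := qform_invmx_le (z r) A'p Ap q2.
have e0 := expR_gt0 eta.
have f1 : leverage theta' A' p <= expR eta ^+ 2 * leverage theta A p.
  rewrite /leverage (_ : _ ^+ 2 * _ =
    (expR eta * weight theta p) * (expR eta * qform (invmx A) (z p))); last by ring.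
  by apply: ler_pM => //; [exact/ltW/weight_gt0|exact: qform_invmx_ge0].
have f2 : leverage theta A p0 <= expR eta ^+ 2 * leverage theta' A' p0.
  rewrite /leverage (_ : _ ^+ 2 * _ =
    (expR eta * weight theta' p0) * (expR eta * qform (invmx A') (z p0))); last by ring.
  by apply: ler_pM => //; [exact/ltW/weight_gt0|exact: qform_invmx_ge0].
have -> : expR (4 * eta) = expR eta ^+ 2 * expR eta ^+ 2.
  by rewrite -exprD expRM_natl.
rewrite -mulrA; apply: (le_trans f1); rewrite ler_wpM2l ?exprn_ge0 ?(ltW e0)//.
exact: le_trans lev f2.
Qed.

(** * Optimality conditions for the D-optimal design *)

Section Optimal.
Variables (theta : 'rV[R]_d) (xs : T -> R).
Local Notation M xi := (infoM z b xi theta).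
Hypothesis xs_design : is_design xs.
Hypothesis xs_opt : forall xi, is_design xi -> \det (M xi) <= \det (M xs).
Hypothesis xs_pos : posdef (M xs).

(** Mixing [xi] with a point mass at [p] in proportion [r] gives a design, whose determinant cannot
    exceed the optimal one. *)
Lemma det_leverage_le xi p r : is_design xi -> posdef (M xi) -> 0 <= r ->
  \det (M xi) * (1 + r * leverage theta (M xi) p) <= (1 + r) ^+ d * \det (M xs).
Proof.
move=> xid Mp r0; have r1 : 0 < 1 + r by rewrite ltr_wpDr.
have [xi' /xs_opt] := infoM_mix theta p xid r0.
move=> h xi'E; move: h; rewrite xi'E detZ det_info ?posdef_unit// exprVn mulrC.
by rewrite ler_pdivrMr ?exprn_gt0// [X in _ <= X]mulrC.
Qed.

(* The Kiefer-Wolfowitz condition. *)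
Lemma optimal_leverage_le p : leverage theta (M xs) p <= d%:R.
Proof.
rewrite leNgt; apply/negP => ad; set a := leverage _ _ _ in ad.
have d0 : 0 <= d%:R :> R by [].
have a0 : 0 < a by exact: le_lt_trans ad.
(* Small enough that the first-order gain [r * (a - d%:R)] beats the second-order loss
   [r ^+ 2 * a * d%:R]. *)
pose r := (a - d%:R) / (2 * a * (d%:R + 1)).
have den : 0 < 2 * a * (d%:R + 1).
  by apply: mulr_gt0; [exact: mulr_gt0|lra].
have r0 : 0 < r by rewrite divr_gt0// subr_gt0.
have rE : r * (2 * a * (d%:R + 1)) = a - d%:R by rewrite divfK// lt0r_neq0.
have := det_leverage_le p xs_design xs_pos (ltW r0); rewrite -/a mulrC.
rewrite ler_pM2r ?posdef_det_gt0// => h1.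
have dr : d%:R * r <= 1 by rewrite /r mulrA ler_pdivrMr// mul1r; nra.
have h2 : (1 + r) ^+ d * (1 - d%:R * r) <= 1.
  apply: (@le_trans _ _ (expR (d%:R * r) * expR (- (d%:R * r)))); last first.
    by rewrite -expRD subrr expR0.
  apply: (@le_trans _ _ (expR (d%:R * r) * (1 - d%:R * r))); last first.
    by rewrite ler_wpM2l ?expR_ge0// -[leLHS]/(1 + - _) expR_ge1Dx.
  rewrite ler_wpM2r ?subr_ge0// expRM_natl lerXn2r ?nnegrE ?expR_ge0 ?expR_ge1Dx//.
  by lra.
have h3 : (1 + r * a) * (1 - d%:R * r) <= 1.
  by apply: le_trans h2; rewrite ler_wpM2r// subr_ge0.
have h4 : a - d%:R - r * a * d%:R <= 0.
  by rewrite -(pmulr_rle0 _ r0); nra.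
nra.
Qed.

Lemma optimal_trace_le xi : is_design xi -> \tr (invmx (M xs) *m M xi) <= d%:R.
Proof.
move=> [xi0 xi1]; rewrite trace_infoM.
apply: (@le_trans _ _ (\sum_p xi p * d%:R)); last by rewrite -mulr_suml xi1 mul1r.
by apply: ler_sum => p _; rewrite ler_wpM2l// optimal_leverage_le.
Qed.

(** [det_leverage_le] with [r = 1]: a huge leverage would let one point mass push the determinant
    above the optimum. *)
Lemma leverage_le_det xi p : is_design xi -> posdef (M xi) ->
  leverage theta (M xi) p <= 2 ^+ d * expR (ln (\det (M xs)) - ln (\det (M xi))).
Proof.
move=> xid Mp; have M0 := posdef_det_gt0 Mp; have Ms0 := posdef_det_gt0 xs_pos.
have := det_leverage_le p xid Mp ler01.
rewrite mul1r expRB !lnK ?posrE// mulrA ler_pdivlMr// (_ : 1 + 1 = 2)//.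
by apply: le_trans; rewrite [leLHS]mulrC ler_wpM2l ?(ltW M0)// lerDr.
Qed.

(** The tangent inequality for log det at [A], evaluated at the optimal matrix. *)
Lemma mean_leverage_ge A : posdef A ->
  d%:R + (ln (\det (M xs)) - ln (\det A)) <= \sum_p xs p * leverage theta A p.
Proof. by move=> Ap; rewrite -trace_infoM; exact: logdet_concave. Qed.

End Optimal.
End Design.

(** * Convergence of the greedy design *)

Section Limits.
Context {R : realType}.

Lemma cvg_mx_entries m n (F : nat -> 'M[R]_(m, n)) (A : 'M[R]_(m, n)) :
  (forall i j, (fun t => F t i j) @ \oo --> A i j) -> F @ \oo --> A.
Proof.
move=> FA; apply/cvg_ballP => e e0.
have : \forall t \near \oo, forall i j, ball (A i j) e (F t i j).
  apply: filter_forall => i; apply: filter_forall => j.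
  by move/cvg_ballP : (FA i j); exact.
by apply: filterS => t h; split.
Qed.

(** The quantity [(t%:R - 1) * u t] grows by at most [e t] per step, so [u] is dominated by an
    average of [e] and a vanishing initial term. *)
Lemma averaging_cvg0 (u e : nat -> R) t1 :
  (forall t, (t1 <= t)%N -> 0 <= u t) ->
  (forall t, (t1 <= t)%N -> t%:R * u t.+1 <= (t%:R - 1) * u t + e t) ->
  e @ \oo --> 0 -> u @ \oo --> 0.
Proof.
move=> u0 urec /cvgr0Pnorm_le e_cvg; apply/cvgr0Pnorm_le => eps eps0.
have eps2 : 0 < eps / 2 by rewrite divr_gt0.
have [N _ HN] := e_cvg _ eps2.
pose n0 := maxn N (maxn t1 1).
have n0t : (t1 <= n0)%N by rewrite !leq_max leqnn orbT.
have n01 : (1 <= n0)%N by rewrite !leq_max leqnn !orbT.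
have n0N : (N <= n0)%N by rewrite leq_max leqnn.
pose C := (n0%:R - 1) * u n0.
have rec k : ((n0 + k)%:R - 1) * u (n0 + k)%N <= C + k%:R * (eps / 2).
  elim: k => [|k IH]; first by rewrite addn0 mul0r addr0.
  have tk : (t1 <= n0 + k)%N by rewrite (leq_trans n0t)// leq_addr.
  have := urec _ tk; rewrite -addnS addnS -[(n0 + k).+1%:R]natr1 addrK => /le_trans; apply.
  have : e (n0 + k)%N <= eps / 2.
    apply: le_trans (ler_norm _) _; apply: HN => /=.
    by rewrite (leq_trans n0N)// leq_addr.
  move: IH; rewrite -[k.+1%:R]natr1; lra.
have C0 : 0 <= C.
  by rewrite mulr_ge0 ?u0// subr_ge0 ler1n.
(* After [K] steps the initial constant [C] is at most [eps / 2] per step. *)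
pose K := (Num.truncn (C / (eps / 2))).+1.
exists (n0 + K)%N => // t /= tK.
have tE : t = (n0 + (t - n0))%N by rewrite subnKC// (leq_trans _ tK)// leq_addr.
have kK : (K <= t - n0)%N by rewrite leq_subRL// (leq_trans _ tK)// leq_addr.
set k := (t - n0)%N in tE kK.
have kC : C <= k%:R * (eps / 2).
  rewrite -ler_pdivrMr//; apply: le_trans (ltW (truncnS_gt _)) _.
  by rewrite ler_nat.
have k0 : 0 < k%:R :> R by rewrite ltr0n (leq_trans _ kK).
have ut : 0 <= u t by rewrite u0// tE (leq_trans n0t)// leq_addr.
rewrite ger0_norm//; have := rec k; rewrite -tE => h.
rewrite -(ler_pM2l k0); apply: (@le_trans _ _ ((t%:R - 1) * u t)); last by lra.
rewrite ler_wpM2r// tE natrD; have : 1 <= n0%:R :> R by rewrite ler1n.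
lra.
Qed.

Lemma cvg_natV : (fun t : nat => t%:R^-1 : R) @ \oo --> (0 : R).
Proof.
apply/(gtr0_cvgV0 (f := fun t : nat => t%:R : R)); last exact: cvgr_idn.
by exists 1%N => // t /= t0; rewrite ltr0n.
Qed.

Lemma cvg_sqrt0 (u : nat -> R) (K : R) :
  u @ \oo --> 0 -> (fun t => K * Num.sqrt (u t)) @ \oo --> 0.
Proof.
move=> u0; rewrite -(mulr0 K) -[X in K * X](@sqrtr0 R); apply: cvgMr.
by apply: (@cvg_comp _ _ _ u (@Num.sqrt R) _ _ _ u0); exact: sqrt_continuous.
Qed.

(** Apply [ln v <= v - 1] to the inverse of [1 + x]. *)
Lemma ln1D_ge (x : R) : 0 <= x -> x - x ^+ 2 <= ln (1 + x).
Proof.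
move=> x0; have x1 : 0 < 1 + x by rewrite ltr_wpDr.
have : ln ((1 + x)^-1) <= (1 + x)^-1 - 1.
  rewrite -{1}[(1 + x)^-1](subrK 1) addrC; apply: le_ln1Dx.
  by rewrite ltrBDr addrC subrr invr_gt0.
rewrite lnV ?posrE//.
have : x - x ^+ 2 <= 1 - (1 + x)^-1.
  rewrite -(ler_pM2r x1) [leRHS]mulrBl mulVf ?lt0r_neq0//; nra.
lra.
Qed.

(** On the unit interval a convex function lies below its chord. *)
Lemma expr1D_le (r : R) d : 0 <= r <= 1 -> (1 + r) ^+ d <= 1 + (2 ^+ d - 1) * r.
Proof.
move=> /andP[r0 r1]; elim: d => [|d IH]; first by rewrite !expr0; lra.
have p1 : 1 <= 2 ^+ d :> R by rewrite exprn_ege1// ler1n.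
have : 0 <= (2 ^+ d - 1) * (r * (1 - r)) by rewrite !mulr_ge0 ?subr_ge0.
have r2 : 0 <= 1 + r by rewrite addr_ge0.
rewrite !exprS => h; apply: le_trans (ler_wpM2l r2 IH) _; lra.
Qed.

End Limits.

(** * The recursion for the determinant gap under near-greedy choices *)

Section Sequential.
Context {R : realType} {T : finType} {d : nat}.
Variables (z : T -> 'rV[R]_d) (b : T -> R).
Hypothesis b_gt0 : forall p, 0 < b p.
Variables (theta : 'rV[R]_d) (xs : T -> R).
Hypothesis xs_design : is_design xs.
Hypothesis xs_opt : forall xi, is_design xi ->
  \det (infoM z b xi theta) <= \det (infoM z b xs theta).
Hypothesis xs_pos : posdef (infoM z b xs theta).
Variables (q : nat -> T) (t1 : nat).
Hypothesis t1_gt0 : (0 < t1)%N.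
Local Notation M t := (infoM z b (@empirical R T q t) theta).
Local Notation Ms := (infoM z b xs theta).
Hypothesis M_pos : forall t, (t1 <= t)%N -> posdef (M t).
Local Notation lev t p := (leverage z b theta (M t) p).

Definition det_gap t : R :=
  ln (\det Ms) - ln (\det (M t)).

Let t_gt0 t : (t1 <= t)%N -> (0 < t)%N.
Proof. exact: leq_trans. Qed.

Lemma det_gap_ge0 t : (t1 <= t)%N -> 0 <= det_gap t.
Proof.
move=> tt; have Ms0 := posdef_det_gt0 xs_pos; have M0 := posdef_det_gt0 (M_pos tt).
rewrite subr_ge0 ler_ln ?posrE//.
exact/xs_opt/empirical_design/t_gt0.
Qed.

Lemma det_gapS t : (t1 <= t)%N ->
  det_gap t.+1 = det_gap t + d%:R * ln (1 + t%:R^-1) - ln (1 + t%:R^-1 * lev t (q t)).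
Proof.
move=> tt; have t0 := t_gt0 tt; have Mp := M_pos tt.
have r0 : 0 < t%:R^-1 :> R by rewrite invr_gt0 ltr0n.
have r1 : 0 < 1 + t%:R^-1 :> R by rewrite addr_gt0.
have l0 : 0 <= lev t (q t) by exact: leverage_ge0.
have l1 : 0 < 1 + t%:R^-1 * lev t (q t).
  by apply: (lt_le_trans ltr01); rewrite lerDl mulr_ge0// ltW.
have M0 := posdef_det_gt0 Mp.
rewrite /det_gap [M t.+1](infoM_empiricalS _ _ _ _ t0) detZ det_info ?posdef_unit//.
rewrite lnM ?posrE ?exprn_gt0 ?invr_gt0 ?mulr_gt0//.
rewrite lnM ?posrE// exprVn lnV ?posrE ?exprn_gt0// lnXn// -mulr_natl; ring.
Qed.

Lemma greedy_leverage_ge t (rho : R) : (t1 <= t)%N ->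
  (forall p, lev t p <= rho * lev t (q t)) -> d%:R + det_gap t <= rho * lev t (q t).
Proof.
move=> tt h; apply: le_trans (mean_leverage_ge xs_pos (M_pos tt)) _.
apply: (@le_trans _ _ (\sum_p xs p * (rho * lev t (q t)))).
  by apply: ler_sum => p _; apply: ler_wpM2l; [exact: xs_design.1|exact: h].
by rewrite -mulr_suml xs_design.2 mul1r.
Qed.

(** If the chosen leverage is at least [2 ^+ d], the gap does not grow. Otherwise
    [greedy_leverage_ge] already bounds the gap, and one step adds at most [d%:R]. *)
Lemma det_gap_bounded (rho : R) : 0 < rho ->
  (forall t p, (t1 <= t)%N -> lev t p <= rho * lev t (q t)) ->
  exists D, forall t, (t1 <= t)%N -> det_gap t <= D.
Proof.
move=> rho0 h; exists (Num.max (det_gap t1) (rho * 2 ^+ d + d%:R)) => t.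
elim: t => [|t IH]; first by rewrite leqn0 => /eqP t10; move: t1_gt0; rewrite t10.
rewrite leq_eqVlt => /orP[/eqP<-|]; first by rewrite le_max lexx.
rewrite ltnS => tt; have {}IH := IH tt.
have t0 := t_gt0 tt; have Mp := M_pos tt.
have r0 : 0 < t%:R^-1 :> R by rewrite invr_gt0 ltr0n.
have r1 : t%:R^-1 <= 1 :> R by rewrite invf_le1 ?ltr0n// ler1n.
have l0 : 0 <= lev t (q t) by exact: leverage_ge0.
have lr0 : 0 <= t%:R^-1 * lev t (q t) by rewrite mulr_ge0// ltW.
have gl := greedy_leverage_ge tt (fun p => h t p tt).
rewrite det_gapS//; case: (leP (2 ^+ d) (lev t (q t))) => hl.
  apply: le_trans IH; suff : d%:R * ln (1 + t%:R^-1) <= ln (1 + t%:R^-1 * lev t (q t)) by lra.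
  rewrite mulr_natl -lnXn ?addr_gt0// ler_ln ?posrE ?exprn_gt0 ?addr_gt0//; last first.
    by rewrite mulr_gt0//; apply: lt_le_trans hl; rewrite exprn_gt0.
  apply: le_trans (expr1D_le d _) _; first by rewrite (ltW r0).
  rewrite lerD2l mulrC ler_pM2l//; lra.
rewrite le_max; apply/orP; right.
have : d%:R * ln (1 + t%:R^-1) <= d%:R :> R.
  rewrite -[leRHS]mulr1 ler_wpM2l//; apply: le_trans (le_ln1Dx _) r1; lra.
have : 0 <= ln (1 + t%:R^-1 * lev t (q t)) by rewrite ln_ge0// lerDl.
have : rho * lev t (q t) <= rho * 2 ^+ d by rewrite ler_pM2l// ltW.
have : 0 <= d%:R :> R by [].
lra.
Qed.

Lemma det_gap_cvg0 (rho : nat -> R) D : (forall t, 1 <= rho t) ->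
  (forall t p, (t1 <= t)%N -> lev t p <= rho t * lev t (q t)) ->
  (forall t, (t1 <= t)%N -> det_gap t <= D) ->
  rho @ \oo --> (1 : R) -> det_gap @ \oo --> 0.
Proof.
move=> rho1 h gD rho_cvg; pose L := 2 ^+ d * expR D.
have L0 : 0 <= L by rewrite mulr_ge0 ?exprn_ge0 ?expR_ge0.
(* The first error term is the cost of a choice that is greedy only up to [rho t], the second bounds
   the quadratic term in [ln1D_ge]. *)
apply: (@averaging_cvg0 _ _
  (fun t => (rho t - 1) * (d%:R + D) + L ^+ 2 * t%:R^-1) t1).
- exact: det_gap_ge0.
- move=> t tt; have t0 := t_gt0 tt; have Mp := M_pos tt.
  have t0' : 0 < t%:R :> R by rewrite ltr0n.
  have r0 : 0 < t%:R^-1 :> R by rewrite invr_gt0.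
  have l0 : 0 <= lev t (q t) by exact: leverage_ge0.
  have lL : lev t (q t) <= L.
    apply: le_trans (leverage_le_det xs_opt xs_pos (q t) _ Mp) _.
      exact: empirical_design.
    by rewrite ler_wpM2l ?exprn_ge0// ler_expR gD.
  have g0 := det_gap_ge0 tt; have gl := greedy_leverage_ge tt (fun p => h t p tt).
  rewrite det_gapS//.
  have tr : t%:R * t%:R^-1 = 1 :> R by rewrite divff// lt0r_neq0.
  have h1 : ln (1 + t%:R^-1) <= t%:R^-1 :> R by apply: le_ln1Dx; lra.
  have h1' : t%:R * (d%:R * ln (1 + t%:R^-1)) <= d%:R :> R.
    rewrite mulrCA; apply: le_trans (ler_wpM2l _ (ler_wpM2l (ltW t0') h1)) _ => //.
    by rewrite tr mulr1.
  have h2 := ln1D_ge (mulr_ge0 (ltW r0) l0).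
  have h3 : lev t (q t) - L ^+ 2 * t%:R^-1 <= t%:R * ln (1 + t%:R^-1 * lev t (q t)).
    apply: le_trans (ler_wpM2l (ltW t0') h2).
    rewrite [leRHS](_ : _ = lev t (q t) - lev t (q t) ^+ 2 * t%:R^-1); last first.
      by field; exact: lt0r_neq0.
    by rewrite lerD2l lerN2 ler_wpM2r ?(ltW r0)// lerXn2r ?nnegrE.
  (* Division by [rho t] is replaced by multiplication by [2 - rho t], since
     [rho t * (2 - rho t) <= 1]. *)
  have h4 : d%:R + det_gap t - (rho t - 1) * (d%:R + D) <= lev t (q t).
    have hr := rho1 t; have hD := gD t tt; have d0 : 0 <= d%:R :> R by [].
    have : (rho t - 1) * (d%:R + det_gap t) <= (rho t - 1) * (d%:R + D).
      by rewrite ler_wpM2l ?subr_ge0// lerD2l.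
    have X0 : 0 <= (rho t - 1) ^+ 2 * (d%:R + det_gap t).
      by rewrite mulr_ge0 ?sqr_ge0// addr_ge0.
    have rho0 : 0 < rho t by exact: lt_le_trans hr.
    suff : d%:R + det_gap t - (rho t - 1) * (d%:R + det_gap t) <= lev t (q t) by lra.
    by rewrite -(ler_pM2l rho0); apply: le_trans gl; lra.
  move: h1' h3 h4; rewrite mulrBr mulrDr; lra.
rewrite -[0]addr0; apply: cvgD.
  rewrite -[X in _ --> X](mul0r (d%:R + D)); apply: cvgMl.
  by rewrite -(subrr 1); apply: cvgB => //; exact: cvg_cst.
rewrite -[X in _ --> X](mulr0 (L ^+ 2)); apply: cvgMr.
exact: cvg_natV.
Qed.

(** By [optimal_trace_le] the Taylor error of log det at the optimal matrix is at most [det_gap t],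
    so [logdet_concave_near] applies. *)
Lemma infoM_empirical_cvg : det_gap @ \oo --> 0 ->
  forall i j, (fun t => M t i j) @ \oo --> Ms i j.
Proof.
move=> g0 i j; have [K K0 HK] := logdet_concave_near xs_pos.
apply/cvgrPdist_le => e e0.
have /cvgr0Pnorm_le/(_ _ e0) h := cvg_sqrt0 K g0.
have /cvgr0Pnorm_le/(_ _ ltr01) g1 := g0.
near=> t; rewrite distrC; apply: (@le_trans _ _ (K * Num.sqrt (det_gap t))).
  have tt : (t1 <= t)%N by near: t; exists t1.
  apply: HK; first exact: M_pos.
    rewrite /det_gap; have := optimal_trace_le xs_design xs_opt xs_pos
      (empirical_design q (t_gt0 tt)).
    by lra.
  by apply: le_trans (ler_norm _) _; near: t.
by apply: le_trans (ler_norm _) _; near: t.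
Unshelve. all: by end_near. Qed.

End Sequential.

(** * The likelihood ratio and the logit shifts *)

Section Likelihood.
Context {R : realType} {T : finType} {d : nat}.
Variables (z : T -> 'rV[R]_d) (b : T -> R).
Hypothesis b_gt0 : forall p, 0 < b p.
Variable ths : 'rV[R]_d.

Definition residual (q : nat -> T) (y : nat -> bool) p t : R :=
  \sum_(s < t) (q s == p)%:R * ((y s)%:R - sigmoid (b p * dotv ths (z p))).

Definition logit_shift (theta : 'rV[R]_d) p : R := b p * dotv (theta - ths) (z p).

Definition kl_pair (theta : 'rV[R]_d) p : R :=
  bernoulli_kl (sigmoid (b p * dotv ths (z p))) (sigmoid (b p * dotv theta (z p))).

(** The log-odds are linear in the parameter, so a response enters the ratio only through
    [logit_shift]; centring it leaves minus the divergence. *)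
Lemma loglikB q y theta t :
  loglik z b q y theta t - loglik z b q y ths t =
  \sum_p logit_shift theta p * (t%:R^-1 * residual q y p t)
    - \sum_p @empirical R T q t p * kl_pair theta p.
Proof.
rewrite empirical_mean /loglik -mulrBr -sumrB.
under [X in _ = X - _]eq_bigr do rewrite mulrCA.
rewrite -mulr_sumr -mulrBr; congr (_ * _).
under [X in _ = X - _]eq_bigr do rewrite /residual mulr_sumr.
rewrite exchange_big /= -sumrB; apply: eq_bigr => s _.
rewrite (bigD1 (q s))//= eqxx mul1r big1 ?addr0; last first.
  by move=> p pq; rewrite eq_sym (negPf pq) mul0r mulr0.
rewrite /logit_shift dotvBl [b _ * (_ - _)]mulrBr /kl_pair /bernoulli_kl.
set w := b (q s) * dotv theta _; set w0 := b (q s) * dotv ths _.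
have := logit_sigmoid w; have := logit_sigmoid w0.
move: (ln (sigmoid w)) (ln (1 - sigmoid w)) (ln (sigmoid w0)) (ln (1 - sigmoid w0)).
by move=> l1 l2 l3 l4 h0 h1; rewrite -{1}h1 -{1}h0; ring.
Qed.

Lemma weight_dotv theta p :
  weight z b ths p * dotv (theta - ths) (z p) ^+ 2 =
  dsigmoid (b p * dotv ths (z p)) * logit_shift theta p ^+ 2.
Proof. by rewrite /weight /logit_shift; ring. Qed.

Lemma qform_logit_shift xi theta :
  qform (infoM z b xi ths) (theta - ths) =
  \sum_p xi p * (dsigmoid (b p * dotv ths (z p)) * logit_shift theta p ^+ 2).
Proof.
rewrite qform_infoM; apply: eq_bigr => p _; congr (_ * _).
exact: weight_dotv.
Qed.

(** Maximality bounds the mean divergence by the residuals, hence the quadratic form of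
    [theta - ths]. The leverage bound carries this over to every pair, even one rarely queried. [K]
    is uniform in the trajectory and in time. *)
Lemma mle_logit_shift_le (B L : R) : 0 <= B -> 0 <= L -> exists2 K : R, 0 <= K &
  forall q y theta t, posdef (infoM z b (@empirical R T q t) ths) ->
  (forall p, leverage z b ths (infoM z b (@empirical R T q t) ths) p <= L) ->
  (forall p, `|logit_shift theta p| <= B) ->
  loglik z b q y ths t <= loglik z b q y theta t ->
  forall p, logit_shift theta p ^+ 2 <= K * \sum_p `|t%:R^-1 * residual q y p t|.
Proof.
move=> B0 L0; pose ds p := dsigmoid (b p * dotv ths (z p)).
have ds0 p : 0 < ds p by exact: dsigmoid_gt0.
pose c := \sum_p (ds p)^-1.
have c0 : 0 <= c by apply: sumr_ge0 => p _; rewrite invr_ge0 ltW.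
have dsc p : (ds p)^-1 <= c.
  by rewrite /c (bigD1 p)//= lerDl sumr_ge0// => r _; rewrite invr_ge0 ltW.
have kl_ge theta p : `|logit_shift theta p| <= B ->
    ds p * logit_shift theta p ^+ 2 <= 16 * expR B * c * kl_pair theta p.
  move=> hB; have := kl_sigmoid_ge (b p * dotv theta (z p)) (b p * dotv ths (z p)).
  rewrite -mulrBr -dotvBl -/(logit_shift theta p) -/(ds p) -/(kl_pair theta p) => hk.
  have k0 : 0 <= kl_pair theta p.
    apply: le_trans hk; apply: divr_ge0 => //.
    by rewrite mulr_ge0 ?sqr_ge0// mulr_ge0 ?sqr_ge0 ?expR_ge0.
  have e1 : 1 <= expR B * expR (- `|logit_shift theta p|).
    by rewrite -expRD -[leLHS]expR0 ler_expR subr_ge0.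
  have d1 : 1 = (ds p)^-1 * ds p by rewrite mulVf// lt0r_neq0.
  apply: (@le_trans _ _ (16 * expR B * (ds p)^-1 * kl_pair theta p)); last first.
    by rewrite ler_wpM2r// ler_wpM2l// mulr_ge0 ?expR_ge0.
  apply: (@le_trans _ _ (16 * expR B * (ds p)^-1 * (ds p ^+ 2 *
    expR (- `|logit_shift theta p|) * logit_shift theta p ^+ 2 / 16))); last first.
    apply: ler_wpM2l => //.
    by do ?apply: mulr_ge0; rewrite ?expR_ge0 ?invr_ge0 ?(ltW (ds0 p)).
  rewrite [leRHS](_ : _ = (expR B * expR (- `|logit_shift theta p|)) *
    (ds p * logit_shift theta p ^+ 2)); last by field; exact: lt0r_neq0.
  by rewrite ler_peMl// mulr_ge0 ?sqr_ge0// ltW.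
exists (c * (L * (16 * expR B * c * B))); first by rewrite !mulr_ge0 ?expR_ge0.
move=> q y theta t Mp lev hB mle p; set U := \sum_p _.
have klU : \sum_p @empirical R T q t p * kl_pair theta p <= B * U.
  apply: (@le_trans _ _ (\sum_p logit_shift theta p * (t%:R^-1 * residual q y p t))).
    by rewrite -subr_ge0 -loglikB subr_ge0.
  rewrite /U mulr_sumr; apply: ler_sum => r _.
  by apply: le_trans (ler_norm _) _; rewrite normrM ler_wpM2r.
have qU : qform (infoM z b (@empirical R T q t) ths) (theta - ths) <=
    16 * expR B * c * (B * U).
  rewrite qform_logit_shift.
  apply: le_trans (_ : 16 * expR B * c *
    (\sum_p @empirical R T q t p * kl_pair theta p) <= _); last first.
    by rewrite ler_wpM2l// !mulr_ge0 ?expR_ge0.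
  rewrite mulr_sumr; apply: ler_sum => r _.
  by rewrite [leRHS]mulrCA ler_wpM2l ?empirical_ge0// kl_ge.
have U0 : 0 <= U by apply: sumr_ge0.
have sq : ds p * logit_shift theta p ^+ 2 <= L * (16 * expR B * c * (B * U)).
  apply: (@le_trans _ _ (leverage z b ths (infoM z b (@empirical R T q t) ths) p *
    qform (infoM z b (@empirical R T q t) ths) (theta - ths))).
    rewrite /leverage -mulrA [qform (invmx _) _ * _]mulrC.
    apply: (@le_trans _ _ (weight z b ths p * dotv (theta - ths) (z p) ^+ 2)).
      by rewrite weight_dotv.
    by rewrite ler_wpM2l ?dotv_sq_le// ltW// weight_gt0.
  by apply: ler_pM; rewrite ?qform_ge0 ?leverage_ge0.
apply: (@le_trans _ _ ((ds p)^-1 * (ds p * logit_shift theta p ^+ 2))).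
  by rewrite mulKf// lt0r_neq0.
rewrite (_ : _ * U = c * (L * (16 * expR B * c * (B * U)))); last by ring.
apply: ler_pM => //; first by rewrite invr_ge0 ltW.
by rewrite mulr_ge0 ?sqr_ge0// ltW.
Qed.

End Likelihood.

(** * Consistency along one fixed trajectory *)

Section Consistency.
Context {R : realType} {T : finType} {d : nat}.
Variables (z : T -> 'rV[R]_d) (b : T -> R).
Hypothesis b_gt0 : forall p, 0 < b p.
Variables (ths : 'rV[R]_d) (xs : T -> R).
Hypothesis xs_design : is_design xs.
Hypothesis xs_opt : forall xi, is_design xi ->
  \det (infoM z b xi ths) <= \det (infoM z b xs ths).
Hypothesis xs_pos : posdef (infoM z b xs ths).
Variables (q : nat -> T) (y : nat -> bool) (th : nat -> 'rV[R]_d) (t1 : nat) (B : R).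
Hypothesis t1_gt0 : (0 < t1)%N.
Local Notation M t theta := (infoM z b (@empirical R T q t) theta).
Hypothesis M_pos : forall t, (t1 <= t)%N -> posdef (M t ths).
Hypothesis Mth_pos : forall t, (t1 <= t)%N -> posdef (M t (th t)).
Hypothesis B_ge0 : 0 <= B.
Hypothesis th_bounded : forall t p, (t1 <= t)%N -> `|logit_shift z b ths (th t) p| <= B.
Hypothesis greedy : forall t p, (t1 <= t)%N ->
  \det (Hmat z b q (th t) t + info (th t) (z p) (b p)) <=
  \det (Hmat z b q (th t) t + info (th t) (z (q t)) (b (q t))).
Hypothesis mle : forall t, (t1 <= t)%N ->
  loglik z b q y ths t <= loglik z b q y (th t) t.
Hypothesis residual_cvg : forall p,
  (fun t => t%:R^-1 * residual z b ths q y p t) @ \oo --> (0 : R).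

Let eta t := \sum_p b p * `|dotv (th t - ths) (z p)|.

Let etaE t : eta t = \sum_p `|logit_shift z b ths (th t) p|.
Proof. by apply: eq_bigr => p _; rewrite /logit_shift normrM gtr0_norm. Qed.

Let eta_ge0 t : 0 <= eta t.
Proof. by rewrite etaE sumr_ge0. Qed.

Let t_gt0 t : (t1 <= t)%N -> (0 < t)%N.
Proof. exact: leq_trans. Qed.

Lemma greedy_leverage_le t p : (t1 <= t)%N ->
  leverage z b ths (M t ths) p <= expR (4 * eta t) * leverage z b ths (M t ths) (q t).
Proof.
move=> tt; have t0 := t_gt0 tt.
apply: (@greedy_leverage _ _ _ z b b_gt0 _ (th t) ths t (q t) (eta t)) => //.
- exact: empirical_ge0.
- exact: Mth_pos.
- exact: M_pos.
- by move=> r; rewrite -HmatE//; exact: greedy.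
Qed.

(** The a priori bound [th_bounded] gives a constant [rho]. Leverages are thus bounded before any
    consistency is known, which avoids a circular argument. *)
Lemma greedy_det_gap_bounded :
  exists D, forall t, (t1 <= t)%N -> det_gap z b ths xs q t <= D.
Proof.
apply: (det_gap_bounded b_gt0 xs_design xs_pos t1_gt0 M_pos
  (rho := expR (4 * (#|T|%:R * B)))); first exact: expR_gt0.
move=> t p tt; apply: le_trans (greedy_leverage_le p tt) _.
apply: ler_wpM2r; first exact: leverage_ge0 (M_pos tt).
rewrite ler_expR ler_wpM2l// etaE.
apply: (@le_trans _ _ (\sum_(p : T) B)); first by apply: ler_sum => r _; exact: th_bounded.
by rewrite sumr_const mulr_natl.
Qed.

Lemma leverage_bounded : exists2 L : R, 0 <= L &
  forall t p, (t1 <= t)%N -> leverage z b ths (M t ths) p <= L.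
Proof.
have [D HD] := greedy_det_gap_bounded.
exists (2 ^+ d * expR D); first by rewrite mulr_ge0 ?exprn_ge0 ?expR_ge0.
move=> t p tt; apply: le_trans (leverage_le_det xs_opt xs_pos p _ (M_pos tt)) _.
  exact/empirical_design/t_gt0.
by rewrite ler_wpM2l ?exprn_ge0// ler_expR HD.
Qed.

Lemma eta_cvg0 : eta @ \oo --> (0 : R).
Proof.
have [L L0 HL] := leverage_bounded.
have [K K0 HK] := mle_logit_shift_le z b_gt0 ths B_ge0 L0.
pose U t : R := \sum_p `|t%:R^-1 * residual z b ths q y p t|.
have U0 : U @ \oo --> (0 : R).
  rewrite [X in _ --> X](_ : _ = \sum_(p : T) (0 : R)); last by rewrite big1.
  apply: cvg_big => [|p _]; first exact: add_continuous.
  rewrite -(@normr0 _ R); apply: cvg_norm.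
  exact: residual_cvg.
have KU0 : (fun t => K * U t) @ \oo --> (0 : R).
  by rewrite -(mulr0 K); apply: cvgMr.
have := cvg_sqrt0 #|T|%:R KU0; apply: squeeze_cvgr; last exact: cvg_cst.
near=> t; rewrite eta_ge0 /= etaE.
have tt : (t1 <= t)%N by near: t; exists t1.
apply: (@le_trans _ _ (\sum_(p : T) Num.sqrt (K * U t))).
  apply: ler_sum => p _; rewrite -sqrtr_sqr ler_wsqrtr//.
  apply: HK => //; [exact: M_pos|by move=> r; exact: HL|by move=> r; exact: th_bounded|].
  exact: mle.
by rewrite sumr_const mulr_natl.
Unshelve. all: by end_near. Qed.

(** The second use of the recursion: now [eta] tends to 0, so the factor [rho] tends to 1. *)
Lemma empirical_info_true_cvg i j : (fun t => M t ths i j) @ \oo --> infoM z b xs ths i j.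
Proof.
apply: (infoM_empirical_cvg xs_design xs_opt xs_pos t1_gt0 M_pos).
have [D HD] := greedy_det_gap_bounded.
apply: (det_gap_cvg0 b_gt0 xs_design xs_opt xs_pos t1_gt0 M_pos
  (rho := fun t => expR (4 * eta t)) _ _ HD).
- by move=> t; rewrite -[leLHS]expR0 ler_expR mulr_ge0.
- by move=> t p; exact: greedy_leverage_le.
rewrite -[X in _ --> X](@expR0 R).
apply: (@cvg_comp _ _ _ (fun t => 4 * eta t) (@expR R) _ (nbhs (0 : R))); last first.
  exact: continuous_expR.
have := @cvgMr R _ _ _ _ 4 _ eta_cvg0; rewrite mulr0; exact.
Qed.

(** Replacing [ths] by [th t] changes each weight by at most a factor [expR (eta t)], uniformly in
    the design. *)
Lemma empirical_info_cvg : (fun t => M t (th t)) @ \oo --> infoM z b xs ths.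
Proof.
apply: cvg_mx_entries => i j.
pose W := \sum_p weight z b ths p * `|((z p)^T *m z p) i j|.
have diff t : (t1 <= t)%N ->
    `|M t (th t) i j - M t ths i j| <= (expR (eta t) - 1) * W.
  move=> tt; rewrite !summxE -sumrB; apply: le_trans (ler_norm_sum _ _ _) _.
  rewrite /W mulr_sumr; apply: ler_sum => p _.
  rewrite !infoE !mxE -mulrBr -mulrBl normrM ger0_norm ?empirical_ge0//.
  have e1 : @empirical R T q t p <= 1.
    have [e0 <-] := empirical_design q (t_gt0 tt) : is_design (@empirical R T q t).
    by rewrite (bigD1 p)//= lerDl sumr_ge0.
  apply: (@le_trans _ _ (1 * `|(weight z b (th t) p - weight z b ths p) *
    (\sum_k (z p)^T i k * z p k j)|)).
    by rewrite ler_wpM2r.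
  rewrite mul1r normrM mulrA; apply: ler_wpM2r => //.
  have w1 := weight_le z b_gt0 (th t) ths p; have w2 := weight_le z b_gt0 ths (th t) p.
  rewrite -/(eta t) in w1; rewrite (_ : \sum_p _ = eta t) in w2; last first.
    by apply: eq_bigr => r _; rewrite !dotvBl distrC.
  have w0 := weight_gt0 z b_gt0 ths p; have w0' := weight_gt0 z b_gt0 (th t) p.
  have ge1 : 1 <= expR (eta t) by rewrite -[leLHS]expR0 ler_expR.
  rewrite ler_norml; apply/andP; split; nra.
rewrite -[X in _ --> X]add0r.
have -> : (fun t => M t (th t) i j) =
    (fun t => (M t (th t) i j - M t ths i j) + M t ths i j).
  by apply/funext => t; rewrite subrK.
apply: cvgD; last exact: empirical_info_true_cvg.
apply/cvgr0Pnorm_le => e e0.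
have : (fun t => (expR (eta t) - 1) * W) @ \oo --> (0 : R).
  rewrite -(mul0r W); apply: cvgMl; rewrite -(subrr 1); apply: cvgB; last exact: cvg_cst.
  rewrite -[X in _ --> X](@expR0 R).
  apply: (@cvg_comp _ _ _ eta (@expR R) _ (nbhs (0 : R))); first exact: eta_cvg0.
  exact: continuous_expR.
move=> /cvgr0Pnorm_le/(_ _ e0) h; near=> t.
have tt : (t1 <= t)%N by near: t; exists t1.
by apply: le_trans (diff t tt) _; apply: le_trans (ler_norm _) _; near: t.
Unshelve. all: by end_near. Qed.

End Consistency.

(** * Law of large numbers for the responses *)

Lemma square_bracket t : (0 < t)%N -> exists k, (k.+1 ^ 2 <= t < k.+2 ^ 2)%N.
Proof.
case: t => // t _; elim: t => [|t [k /andP[k1 k2]]]; first by exists 0%N.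
have [h|h] := leqP (k.+2 ^ 2) t.+2.
  exists k.+1; rewrite h /=; apply: (leq_ltn_trans k2); rewrite ltn_exp2r//.
by exists k; rewrite h (leq_trans k1).
Qed.

(** Between consecutive squares [a] moves by at most their distance, which is negligible against the
    square itself. *)
Lemma cvg_along_squares (R : realType) (a : nat -> R) :
  (forall t, `|a t.+1 - a t| <= 1) ->
  (fun k => ((k.+1 ^ 2)%:R^-1 * a (k.+1 ^ 2)%N) ^+ 2) @ \oo --> (0 : R) ->
  (fun t => t%:R^-1 * a t) @ \oo --> (0 : R).
Proof.
move=> a1 /cvgr0Pnorm_le asq; apply/cvgr0Pnorm_le => e e0.
have lip t k : `|a (t + k)%N - a t| <= k%:R.
  elim: k => [|k IH]; first by rewrite addn0 subrr normr0.
  rewrite addnS (_ : _ - _ = (a (t + k).+1 - a (t + k)%N) + (a (t + k)%N - a t)).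
    by apply: le_trans (ler_normD _ _) _; rewrite -natr1 addrC lerD.
  by rewrite addrA subrK.
have e2 : 0 < (e / 2) ^+ 2 by rewrite exprn_gt0// divr_gt0.
have [K1 _ HK1] := asq _ e2.
(* Chosen so that [6 / e <= k.+1], which is what [h3] needs. *)
pose K2 := (Num.truncn (6 / e)).+1.
exists ((maxn K1 K2).+1 ^ 2)%N => // t /= Ht.
have t0 : (0 < t)%N by apply: leq_trans Ht; rewrite expn_gt0.
have [k /andP[k1 k2]] := square_bracket t0.
have Kk : (maxn K1 K2 <= k)%N.
  by have := leq_ltn_trans Ht k2; rewrite ltn_exp2r// ltnS.
have kK1 : (K1 <= k)%N by apply: leq_trans Kk; rewrite leq_max leqnn.
have kK2 : (K2 <= k)%N by apply: leq_trans Kk; rewrite leq_max leqnn orbT.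
have n0 : 0 < (k.+1)%:R :> R by rewrite ltr0n.
set N := (k.+1 ^ 2)%N in k1.
have N0 : 0 < N%:R :> R by rewrite ltr0n expn_gt0.
have t0' : 0 < t%:R :> R by rewrite ltr0n.
have h1 : `|a N| <= N%:R * (e / 2).
  have := HK1 k kK1; rewrite /= normrX ler_pXn2r ?nnegrE ?divr_ge0 ?(ltW e0)//.
  rewrite -/N normrM gtr0_norm ?invr_gt0// mulrC ler_pdivrMr// mulrC.
  by rewrite [X in _ <= X]mulrC.
have h2 : `|a t - a N| <= 3 * (k.+1)%:R.
  have := lip N (t - N)%N; rewrite subnKC// => /le_trans; apply.
  rewrite -[3]/(3%:R) -natrM ler_nat /N; move: k2; rewrite !expnS !expn0; lia.
have h3 : 3 * (k.+1)%:R <= N%:R * (e / 2).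
  rewrite /N natrX expr2 -mulrA mulrC ler_pM2l//.
  have : 6 / e <= k.+1%:R.
    apply: le_trans (ltW (truncnS_gt _)) _; rewrite ler_nat -/K2.
    exact: leq_trans kK2 _.
  rewrite ler_pdivrMr//; lra.
rewrite normrM gtr0_norm ?invr_gt0// mulrC ler_pdivrMr//.
have -> : a t = (a t - a N) + a N by rewrite subrK.
apply: le_trans (ler_normD _ _) _.
have : N%:R * e <= e * t%:R by rewrite mulrC ler_pM2l// ler_nat.
lra.
Qed.

(** * Orthogonality and second moments of the residuals *)

Section BernoulliLLN.
Context {R : realType} {disp : measure_display} {Omega : measurableType disp}.
Variables (P : probability Omega R) (T : finType).
Variables (q : nat -> Omega -> T) (y : nat -> Omega -> bool) (prob : T -> R).
Hypothesis mq : forall s p, measurable [set w | q s w = p].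
Hypothesis my : forall s, measurable [set w | y s w].
Hypothesis prob01 : forall p, 0 <= prob p <= 1.
Hypothesis bern : cond_bernoulli P q y prob.
Variable p : T.

Let x (r : T * bool) : R := (r.1 == p)%:R * (r.2%:R - prob p).
Let X s w : R := x (q s w, y s w).
Let S t w : R := \sum_(s < t) X s w.

Let X_le1 s w : `|X s w| <= 1.
Proof.
have /andP[p0 p1] := prob01 p; rewrite /X /x /= normrM.
case: eqP => _; rewrite ?normr0 ?mul0r// normr1 mul1r ler_norml.
by case: (y s w); rewrite ?mulr1n ?mulr0n; apply/andP; split; lra.
Qed.

Let S_le t w : `|S t w| <= t%:R.
Proof.
apply: le_trans (ler_norm_sum _ _ _) _; rewrite -[t in leRHS]card_ord -sumr_const.
by apply: ler_sum => s _; exact: X_le1.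
Qed.

Let indicq s p' w : \1_[set w | q s w = p'] w = (q s w == p')%:R :> R.
Proof.
by rewrite indicE; congr (_%:R); congr nat_of_bool; apply/idP/eqP; rewrite inE.
Qed.

Let indicy s w : \1_[set w | y s w] w = (y s w)%:R :> R.
Proof.
by rewrite indicE; congr (_%:R); congr nat_of_bool; apply/idP/idP; rewrite inE.
Qed.

Let mX s : measurable_fun setT (X s).
Proof.
rewrite (_ : X s = (fun w => \1_[set w | q s w = p] w * (\1_[set w | y s w] w - prob p))).
  apply: measurable_funM; first exact: measurable_indic.
  by apply: measurable_funB; [exact: measurable_indic|exact: measurable_cst].
by apply/funext => w; rewrite indicq indicy.
Qed.

Let mS t : measurable_fun setT (S t).
Proof. by apply: measurable_sum => s; exact: mX. Qed.

Lemma bounded_measurable_integrable (f : Omega -> R) M : measurable_fun setT f ->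
  (forall w, `|f w| <= M) -> P.-integrable setT (EFin \o f).
Proof.
move=> mf fM; apply: measurable_bounded_integrable => //; last first.
  by exists M; split; rewrite ?num_real// => m Mm w _; exact: le_trans (fM w) (ltW Mm).
by apply: (le_lt_trans (probability_le1 _ _)) => //; rewrite ltry.
Qed.

(** Histories before time [t] form a finite type. The default [p] is read at time [t] itself, so
    that [E h] also requires the current pair to be [p]. *)
Let hq t (h : {ffun 'I_t -> T * bool}) s : T :=
  if insub s is Some i then (h i).1 else p.
Let hy t (h : {ffun 'I_t -> T * bool}) s : bool :=
  if insub s is Some i then (h i).2 else false.
Let E t (h : {ffun 'I_t -> T * bool}) : set Omega :=
  [set w | (forall s, (s <= t)%N -> q s w = hq h s) /\
           (forall s, (s < t)%N -> y s w = hy h s)].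

Let mE t h : measurable (@E t h).
Proof.
have -> : @E t h =
    (\bigcap_(s in [set s | (s <= t)%N]) [set w | q s w = hq h s]) `&`
    (\bigcap_(s in [set s | (s < t)%N]) [set w | y s w = hy h s]).
  by apply/seteqP; split => w [h1 h2]; split => s hs; [exact: h1|exact: h2|exact: h1|exact: h2].
apply: measurableI; apply: bigcap_measurableType => s _; first exact: mq.
case: (hy h s); first exact: my.
rewrite (_ : mkset _ = ~` [set w | y s w]); first exact/measurableC/my.
by apply/seteqP; split => w /=; case: (y s w).
Qed.

Let hq_in t h (i : 'I_t) : hq h i = (h i).1.
Proof. by rewrite /hq valK. Qed.

Let hy_in t h (i : 'I_t) : hy h i = (h i).2.
Proof. by rewrite /hy valK. Qed.

Let hq_out t (h : {ffun 'I_t -> T * bool}) : hq h t = p.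
Proof. by rewrite /hq insubF// ltnn. Qed.

Let EP t h w : @E t h w <-> q t w = p /\ h = [ffun i : 'I_t => (q i w, y i w)].
Proof.
split=> [[h1 h2]|[h1 ->]].
  split; first by rewrite h1// hq_out.
  apply/ffunP => i; rewrite ffunE h1 ?(ltnW (ltn_ord i))// h2//.
  by rewrite hq_in hy_in -surjective_pairing.
split=> s; last by move=> st; rewrite (hy_in _ (Ordinal st)) ffunE.
rewrite leq_eqVlt => /orP[/eqP ->|st]; first by rewrite hq_out.
by rewrite (hq_in _ (Ordinal st)) ffunE.
Qed.

(** The events [E h] partition the event that [p] is queried at time [t], and the past sum is
    constant on each: a finite sum replaces conditional expectation. *)
Let SX_cylinders t w : S t w * X t w =
  \sum_(h : {ffun 'I_t -> T * bool})
    (\sum_(s < t) x (h s)) * (\1_(E h `&` [set w | y t w]) w - prob p * \1_(E h) w).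
Proof.
have indE h A : ~ @E t h w -> \1_(E h `&` A) w = 0 :> R /\ \1_(E h) w = 0 :> R.
  by move=> nE; split; rewrite indicE memNset// => -[].
have [qp|qp] := eqVneq (q t w) p; last first.
  rewrite /X /x /= (negPf qp) mul0r mulr0 big1// => h _.
  have [|-> ->] := indE h [set w | y t w]; last by rewrite mulr0 subrr mulr0.
  by move=> /EP[/eqP]; rewrite (negPf qp).
rewrite (bigD1 [ffun i : 'I_t => (q i w, y i w)])//= [X in _ = _ + X]big1 ?addr0; last first.
  move=> h hn; have [|-> ->] := indE h [set w | y t w]; last by rewrite mulr0 subrr mulr0.
  by move=> /EP[_ he]; rewrite he eqxx in hn.
congr (_ * _); first by apply: eq_bigr => s _; rewrite ffunE.
have Ew : E [ffun i : 'I_t => (q i w, y i w)] w by apply/EP.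
rewrite indicI /= indicy ![\1_(E _) w]indicE mem_set// /X /x /= qp eqxx.
by rewrite !mul1r mulr1.
Qed.

(** On each cylinder [bern] says exactly that the integral of the centred response vanishes. *)
Let SX_integral t : (\int[P]_w (S t w * X t w)%:E = 0)%E.
Proof.
have mEy h : measurable (@E t h `&` [set w | y t w]) by exact: measurableI.
have int1 A : measurable A -> P.-integrable setT (fun w => (\1_A w)%:E : \bar R).
  exact: integrable_indic.
have int2 A c : measurable A -> P.-integrable setT (fun w => (c * \1_A w)%:E : \bar R).
  by move=> mA; under eq_fun do rewrite EFinM; apply: integrableZl => //; exact: int1.
under eq_integral do rewrite SX_cylinders -sumEFin.
rewrite integral_sum//; last first.
  move=> h; under eq_fun do rewrite EFinM; apply: integrableZl => //.
  by under eq_fun do rewrite EFinB; apply: integrableB => //; [exact: int1|exact: int2].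
rewrite big1// => h _; under eq_integral do rewrite EFinM.
rewrite integralZl//; last first.
  by under eq_fun do rewrite EFinB; apply: integrableB => //; [exact: int1|exact: int2].
rewrite (_ : (\int[P]_w _)%E = 0%E) ?mule0//.
under eq_integral do rewrite EFinB.
rewrite integralB_EFin//; [|exact: int1|exact: int2].
under [X in (_ - X)%E]eq_integral do rewrite EFinM.
rewrite integralZl//; last exact: int1.
rewrite !integral_indic// !setIT.
have := bern t (hq h) (hy h); rewrite -/(E h) hq_out /= => ->.
by rewrite subee// fin_numM// fin_num_measure.
Qed.

(** Expand the square of the sum at time [t.+1]: the cross term has mean 0 and the new square is at
    most 1. *)
Let second_moment t : (\int[P]_w ((S t w) ^+ 2)%:E <= t%:R%:E)%E.
Proof.
elim: t => [|t IH].
  rewrite (_ : (fun w => _) = cst 0%E); first by rewrite integral0.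
  by apply/funext => w; rewrite /S big_ord0 expr0n.
have iS n : P.-integrable setT (EFin \o (fun w => S n w ^+ 2)).
  apply: (@bounded_measurable_integrable _ (n%:R ^+ 2)).
    by apply: measurable_funX; exact: mS.
  by move=> w; rewrite normrX lerXn2r ?nnegrE.
have iSX : P.-integrable setT (EFin \o (fun w => S t w * X t w)).
  apply: (@bounded_measurable_integrable _ t%:R).
    by apply: measurable_funM; [exact: mS|exact: mX].
  move=> w; rewrite normrM -[leRHS]mulr1; apply: ler_pM => //.
have i2SX : P.-integrable setT (EFin \o (fun w => 2 * (S t w * X t w))).
  apply: (@bounded_measurable_integrable _ (2 * t%:R)).
    by apply: measurable_funM => //; apply: measurable_funM; [exact: mS|exact: mX].
  move=> w; rewrite normrM normr_nat ler_wpM2l// normrM -[leRHS]mulr1.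
  by apply: ler_pM.
have i1 : P.-integrable setT (EFin \o (fun w : Omega => 1 : R)).
  by apply: (@bounded_measurable_integrable _ 1) => // w; rewrite normr1.
have i21 : P.-integrable setT (EFin \o (fun w => 2 * (S t w * X t w) + 1)).
  by have := integrableD measurableT i2SX i1.
apply: (@le_trans _ _ (\int[P]_w (S t w ^+ 2 + (2 * (S t w * X t w) + 1))%:E)%E).
  apply: le_integral => //; first exact: (iS t.+1).
    by have := integrableD measurableT (iS t) i21.
  move=> w _; rewrite lee_fin /S big_ord_recr /= -/(S t w).
  have := X_le1 t w; rewrite ler_norml => /andP[? ?]; nra.
under eq_integral do rewrite EFinD.
rewrite (integralD_EFin _ (iS t) i21)//.
rewrite -[t.+1%:R]natr1 EFinD; apply: leeD; first exact: IH.
have e1 : (\int[P]_w (2 * (S t w * X t w) + 1)%:E = 1)%E.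
  under eq_integral do rewrite EFinD.
  rewrite (integralD_EFin _ i2SX i1)//=; under eq_integral do rewrite EFinM.
  rewrite integralZl// SX_integral mule0 add0e.
  rewrite (integral_cst P measurableT 1%E) mul1e; exact: probability_setT.
by rewrite -[leRHS]e1; exact: lexx.
Qed.

(* The second moments of the averages at times [(k + 1) ^ 2] are summable. *)
Lemma bernoulli_residual_cvg :
  {ae P, forall w, (fun t => t%:R^-1 *
    \sum_(s < t) (q s w == p)%:R * ((y s w)%:R - prob p)) @ \oo --> (0 : R)}.
Proof.
pose g k w : R := ((k.+1 ^ 2)%:R^-1 * S (k.+1 ^ 2) w) ^+ 2.
have g0 k w : 0 <= g k w by exact: sqr_ge0.
have mg k : measurable_fun setT (EFin \o g k).
  apply/measurable_EFinP/measurable_funX; apply: measurable_funM => //.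
have gint k : (\int[P]_w (g k w)%:E <= ((k.+1 ^ 2)%:R^-1)%:E)%E.
  rewrite /g; under eq_integral do rewrite exprMn EFinM.
  have n0 : 0 < (k.+1 ^ 2)%:R :> R by rewrite ltr0n expn_gt0.
  have mSn : measurable_fun setT (fun w => (S (k.+1 ^ 2) w ^+ 2)%:E).
    exact/measurable_EFinP/measurable_funX.
  have Sn0 w : [set: Omega] w -> (0 <= (S (k.+1 ^ 2) w ^+ 2)%:E)%E.
    by rewrite lee_fin sqr_ge0.
  have c0 : 0 <= (k.+1 ^ 2)%:R^-1 ^+ 2 :> R by exact: sqr_ge0.
  rewrite (ge0_integralZl_EFin P measurableT Sn0 mSn c0).
  apply: (@le_trans _ _ (((k.+1 ^ 2)%:R^-1 ^+ 2)%:E * (k.+1 ^ 2)%:R%:E)%E).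
    by rewrite lee_pmul2l ?lte_fin ?exprn_gt0 ?invr_gt0.
  by rewrite -EFinM lee_fin expr2 -mulrA mulVf ?mulr1// lt0r_neq0.
(* Telescoping: the inverse square of [u] is at most [2 / u - 2 / (u + 1)] for [u >= 1]. *)
have tele n : \sum_(0 <= k < n) (k.+1 ^ 2)%:R^-1 <= 2 - 2 / (n.+1)%:R :> R.
  elim: n => [|n IH]; first by rewrite big_geq// divr1 subrr.
  rewrite big_nat_recr//=; apply: le_trans (lerD IH (lexx _)) _.
  have n0 : 0 < n.+1%:R :> R by rewrite ltr0n.
  have n1 : 1 <= n.+1%:R :> R by rewrite ler1n.
  rewrite natrX -[n.+2%:R]natr1; move: (n.+1%:R) n0 n1 => u u0 u1.
  rewrite -subr_ge0 (_ : _ - _ = (u - 1) / (u ^+ 2 * (u + 1))).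
    by rewrite divr_ge0 ?subr_ge0// mulr_ge0 ?sqr_ge0// addr_ge0// ltW.
  by field; rewrite !lt0r_neq0// addr_gt0.
have sumfin : (\int[P]_w (\sum_(k <oo) (g k w)%:E) < +oo)%E.
  rewrite integral_nneseries//; last by move=> k w _; rewrite lee_fin.
  apply: (@le_lt_trans _ _ 2%:E); last by rewrite ltry.
  apply: lime_le.
    by apply: is_cvg_nneseries => k _ _; apply: integral_ge0 => w _; rewrite lee_fin.
  apply: nearW => n; apply: (@le_trans _ _ (\sum_(0 <= k < n) ((k.+1 ^ 2)%:R^-1)%:E)%E).
    by apply: lee_sum => k _; exact: gint.
  rewrite sumEFin lee_fin; apply: le_trans (tele n) _.
  by rewrite gerBl divr_ge0.
have iG : P.-integrable setT (fun w => \sum_(k <oo) (g k w)%:E)%E.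
  apply/integrableP; split.
    by apply: ge0_emeasurable_sum => [k w _ _|k _]; [rewrite lee_fin|exact: mg].
  rewrite (eq_integral (fun w => \sum_(k <oo) (g k w)%:E)%E)//.
  by move=> w _; rewrite gee0_abs//; apply: nneseries_ge0 => k _ _; rewrite lee_fin.
(* An integrable series is almost surely finite, so its terms [g k w] tend to 0. *)
have := integrable_ae measurableT iG; apply: filterS => w /(_ I) fin.
apply: (@cvg_along_squares _ (S ^~ w)).
  by move=> t; rewrite /S big_ord_recr /= [_ + X t w]addrC addrK; exact: X_le1.
rewrite -/(g _ w); apply: cvg_series_cvg_0; apply: nondecreasing_is_cvgn.
  by apply: nondecreasing_series => k _ _; exact: g0.
exists (fine (\sum_(k <oo) (g k w)%:E)) => _ [n _ <-].
rewrite -lee_fin fineK// /series /= -sumEFin; apply: nneseries_lim_ge.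
by move=> k _ _; rewrite lee_fin; exact: g0.
Qed.

End BernoulliLLN.

(** * Bounded logit shifts and positive definiteness along the run *)

Section Boundedness.
Context {R : realType} {T : finType} {d : nat}.
Variables (z : T -> 'rV[R]_d) (b : T -> R).
Hypothesis b_gt0 : forall p, 0 < b p.

Lemma entry_le_norm2 (v : 'rV[R]_d) i : `|v 0 i| <= norm2 v.
Proof.
rewrite -sqrtr_sqr ler_wsqrtr// (bigD1 i)//= lerDl sumr_ge0// => k _.
exact: sqr_ge0.
Qed.

Lemma logit_shift_le (C : R) (theta ths : 'rV[R]_d) p :
  norm2 theta <= C -> norm2 ths <= C ->
  `|logit_shift z b ths theta p| <= \sum_p b p * \sum_i 2 * C * `|z p 0 i|.
Proof.
move=> hC hC'; have C0 : 0 <= C by apply: le_trans hC; exact: sqrtr_ge0.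
rewrite [leRHS](bigD1 p)//= -[leLHS]addr0; apply: lerD; last first.
  by apply: sumr_ge0 => r _; rewrite mulr_ge0 ?(ltW (b_gt0 r))// sumr_ge0// => i _;
     rewrite !mulr_ge0.
rewrite /logit_shift normrM gtr0_norm// ler_pM2l// /dotv mxE.
apply: le_trans (ler_norm_sum _ _ _) _; apply: ler_sum => i _.
rewrite !mxE normrM ler_wpM2r//; apply: le_trans (ler_normB _ _) _.
have h1 := le_trans (entry_le_norm2 theta i) hC.
have h2 := le_trans (entry_le_norm2 ths i) hC'.
by rewrite mulr_natl mulr2n lerD.
Qed.

Lemma Hmat_posdef_mono q theta t0 t : (t0 <= t)%N ->
  posdef (Hmat z b q theta t0) -> posdef (Hmat z b q theta t).
Proof.
move=> + H0; elim: t => [|t IH]; first by rewrite leqn0 => /eqP <-.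
rewrite leq_eqVlt => /orP[/eqP<-//|/IH Ht].
rewrite /Hmat big_ord_recr /=; apply: posdefD_rank1 => //.
exact/ltW/weight_gt0.
Qed.

Lemma Hmat_posdef q theta t : posdef (infoM z b (@empirical R T q t) theta) ->
  posdef (Hmat z b q theta t).
Proof.
(* At [t = 0] both matrices are empty sums, so the hypothesis is the conclusion. *)
case: t => [|t] Mp; last by rewrite HmatE//; exact: posdefZ.
by move: Mp; rewrite /infoM empirical_sum /Hmat !big_ord0 scaler0.
Qed.

End Boundedness.

(* Query pairs are indexed by ('I_n * 'I_m): p = (i, j) means candidate z^(i)
   asked to teacher j, whose rationality on category k(z^(i)) = cat i is
   beta (cat i) j.  Time is 0-based: q s is the (s+1)-th query, th N the
   estimate after N observations. *)
Theorem theoremS (R : realType) (d n m g : nat)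
  (X A : Type) (phi : X -> A -> 'rV[R]_d)
  (x : 'I_n -> X) (a0 a1 : 'I_n -> A)
  (cat : 'I_n -> 'I_g) (beta : 'I_g -> 'I_m -> R)
  (Theta : set 'rV[R]_d) (thstar : 'rV[R]_d)
  (xistar : ('I_n * 'I_m)%type -> R)
  (disp : measure_display) (Omega : measurableType disp)
  (P : probability Omega R)
  (t0 : nat) (init : nat -> ('I_n * 'I_m)%type)
  (q : nat -> Omega -> ('I_n * 'I_m)%type)
  (y : nat -> Omega -> bool)
  (th : nat -> Omega -> 'rV[R]_d) :
  let zof := fun p : ('I_n * 'I_m)%type => zcand phi x a0 a1 p.1 in
  let bof := fun p : ('I_n * 'I_m)%type => beta (cat p.1) p.2 in
  (* setting *)
  compact Theta -> Theta thstar ->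
  (forall k j, 0 < beta k j) ->
  (* D-optimal design at theta* *)
  is_design xistar ->
  (forall xi, is_design xi -> \det (infoM zof bof xi thstar) <= \det (infoM zof bof xistar thstar)) ->
  (* Assumption 1 *)
  posdef (infoM zof bof xistar thstar) ->
  (* Assumption 2 *)
  (exists Cth Cbe Cph : R, 0 < Cth /\ 0 < Cbe /\ 0 < Cph /\
      (forall theta, Theta theta -> norm2 theta <= Cth) /\
      (forall k j, `|beta k j| < Cbe) /\
      (forall x0 a, norm2 (phi x0 a) <= Cph)) ->
  identifiable zof bof Theta thstar ->
  (* measurability of the (discrete) random pairs and responses *)
  (forall s p, measurable [set w | q s w = p]) ->
  (forall s, measurable [set w | y s w]) ->
  (* responses are conditionally Bernoulli(mu(beta theta*^T z)) *)
  cond_bernoulli P q y (fun p => sigmoid (bof p * dotv thstar (zof p))) ->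
  (* initial pairs *)
  (forall s w, (s < t0)%N -> q s w = init s) ->
  (forall theta, Theta theta -> posdef (infoM zof bof (@empirical R _ init t0) theta)) ->
  (* D-optimal active selection *)
  (forall t w, (t0 <= t)%N -> forall p,
      \det (Hmat zof bof (q^~ w) (th t w) t + info (th t w) (zof p) (bof p))
      <= \det (Hmat zof bof (q^~ w) (th t w) t
               + info (th t w) (zof (q t w)) (bof (q t w)))) ->
  (* maximum likelihood estimation over Theta *)
  (forall t w, (t0 < t)%N ->
      Theta (th t w) /\
      forall theta, Theta theta ->
        loglik zof bof (q^~ w) (y^~ w) theta t <= loglik zof bof (q^~ w) (y^~ w) (th t w) t) ->
  {ae P, forall w,
    (fun T : nat => infoM zof bof (@empirical R _ (q^~ w) T) (th T w)) @ \oo -->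
      infoM zof bof xistar thstar}.
Proof.
move=> zof bof _ Ts beta0 xd xopt xpos [Cth [Cbe [Cph [_ [_ [_ [HC _]]]]]]] _ mq my bern.
move=> hinit ipos greedy mle.
have b0 p : 0 < bof p by exact: beta0.
(* There are finitely many pairs, so one almost sure event serves them all. *)
have res_ae : {ae P, forall w, forall p, (fun t => t%:R^-1 *
    residual zof bof thstar (q^~ w) (y^~ w) p t) @ \oo --> (0 : R)}.
  apply: filter_forall => p; apply: (bernoulli_residual_cvg mq my _ bern) => r.
  by rewrite !ltW ?sigmoid_gt0 ?sigmoid_lt1.
apply: filterS res_ae => w res.
have Mpos theta t : Theta theta -> (t0 < t)%N ->
    posdef (infoM zof bof (@empirical R _ (q^~ w) t) theta).
  move=> Tth tt; have t_gt0 : 0 < t%:R :> R by rewrite ltr0n (leq_trans _ tt).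
  have : posdef (Hmat zof bof (q^~ w) theta t).
    apply: (Hmat_posdef_mono b0 (ltnW tt)).
    have := Hmat_posdef (ipos theta Tth); rewrite /Hmat; congr (posdef _).
    by apply: eq_bigr => s _; rewrite hinit.
  rewrite HmatE ?(leq_trans _ tt)// => /(posdefZ _); move=> /(_ t%:R^-1).
  by rewrite invr_gt0 scalerA mulVf ?scale1r ?lt0r_neq0//; exact.
(* The start is [t0.+1] because [mle] constrains the estimates only after time [t0]; it also makes
   [t1] positive. *)
apply: (empirical_info_cvg b0 xd xopt xpos (y := y^~ w) (t1 := t0.+1)
  (B := \sum_p bof p * \sum_i 2 * Cth * `|zof p 0 i|)) => //.
- by move=> t tt; exact: Mpos.
- by move=> t tt; apply: Mpos => //; exact: (mle t w tt).1.
- apply: sumr_ge0 => p _; rewrite mulr_ge0 ?(ltW (b0 p))// sumr_ge0// => i _.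
  by rewrite !mulr_ge0//; apply: le_trans (HC _ Ts); exact: sqrtr_ge0.
- move=> t p tt; apply: logit_shift_le => //; last exact: HC.
  by apply: HC; exact: (mle t w tt).1.
- by move=> t p tt; apply: greedy; exact: ltnW.
- by move=> t tt; exact: (mle t w tt).2.
Qed.
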